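(* For every pair of integers $k,h\geq 1$ there exist polynomials $p_{k,h}(t)$, $q_{k,h}(t)$, $z_{k,h}(t)\in\mathbb{Z}[t]$ with the following property: for every matroid $\mathsf{M}$ of rank $k$ having a stressed hyperplane $H$ with $|H|=h$, if $\widetilde{\mathsf{M}}$ denotes the relaxation of $\mathsf{M}$ at $H$, then \[ P_{\widetilde{\mathsf{M}}}(t) = P_{\mathsf{M}}(t)+p_{k,h}(t),\quad Q_{\widetilde{\mathsf{M}}}(t) = Q_{\mathsf{M}}(t)+q_{k,h}(t),\quad Z_{\widetilde{\mathsf{M}}}(t) = Z_{\mathsf{M}}(t)+z_{k,h}(t).\]
   Context: A hyperplane of a matroid $\mathsf{M}$ of rank $k$ is a flat of rank $k-1$; it is stressed if all its subsets of cardinality $k$ are circuits. If $\mathsf{M}=(E,\mathscr{B})$ has a stressed hyperplane $H$, the relaxation of $\mathsf{M}$ at $H$ is the matroid $\widetilde{\mathsf{M}}=(E,\mathscr{B}\sqcup\{S\subseteq H:|S|=k\})$ (this is a matroid). For a matroid $\mathsf{M}$ on $E$ with lattice of flats $\mathscr{L}(\mathsf{M})$ and a flat $F$: $\mathsf{M}^F$ is the localization (the matroid on $F$ whose flats are the flats of $\mathsf{M}$ contained in $F$) and $\mathsf{M}_F$ is the contraction (the matroid on $E\smallsetminus F$ whose flats are the sets $F'\smallsetminus F$ for flats $F'\supseteq F$). $\chi_{\mathsf{M}}(t)$ is the characteristic polynomial of $\mathsf{M}$. The Kazhdan–Lusztig polynomial $P_{\mathsf{M}}(t)\in\mathbb{Z}[t]$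 is the unique assignment such that: if $\operatorname{rk}(\mathsf{M})=0$ then $P_{\mathsf{M}}=1$ if the ground set is empty and $P_{\mathsf{M}}=0$ otherwise; if $\operatorname{rk}(\mathsf{M})>0$ then $\deg P_{\mathsf{M}}<\operatorname{rk}(\mathsf{M})/2$; and $t^{\operatorname{rk}(\mathsf{M})}P_{\mathsf{M}}(t^{-1})=\sum_{F\in\mathscr{L}(\mathsf{M})}\chi_{\mathsf{M}^F}(t)P_{\mathsf{M}_F}(t)$. The inverse Kazhdan–Lusztig polynomial $Q_{\mathsf{M}}(t)$ is the unique assignment satisfying the same first two conditions and $(-t)^{\operatorname{rk}(\mathsf{M})}Q_{\mathsf{M}}(t^{-1})=\sum_{F\in\mathscr{L}(\mathsf{M})}(-1)^{\operatorname{rk}(F)}Q_{\mathsf{M}^F}(t)\,t^{\operatorname{rk}(\mathsf{M})-\operatorname{rk}(F)}\chi_{\mathsf{M}_F}(t^{-1})$. The $Z$-polynomial is $Z_{\mathsf{M}}(t)=\sum_{F\in\mathscr{L}(\mathsf{M})}t^{\operatorname{rk}(F)}P_{\mathsf{M}_F}(t)$. *)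

(* Defs.v *)
From HB Require Import structures.
From mathcomp Require Import all_boot all_order all_algebra.
From mathcomp Require Import zify.

Set Implicit Arguments.
Unset Strict Implicit.
Unset Printing Implicit Defensive.

Import GRing.Theory.

Section MatroidDef.
Context {T : finType}.
Implicit Types (A B F I J : {set T}).

Definition base_exchange (bs : {set {set T}}) : bool :=
  [forall B1 in bs, forall B2 in bs, forall x in B1 :\: B2,
     exists y in B2 :\: B1, (y |: B1 :\ x) \in bs].

Definition is_matroid (EB : {set T} * {set {set T}}) : bool :=
  [&& EB.2 != set0, [forall B in EB.2, B \subset EB.1] & base_exchange EB.2].

End MatroidDef.

(* A matroid is a pair (E, B) whose ground set E may be any subset of T, so that
   minors live on the same type; the axioms are boolean, which makes
   [matroid T] a finite type. *)
Record matroid (T : finType) :=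
  Matroid { mpair : {set T} * {set {set T}}; _ : is_matroid mpair }.
HB.instance Definition _ (T : finType) := [isSub for @mpair T].
HB.instance Definition _ (T : finType) := [Finite of matroid T by <:].

Definition ground (T : finType) (M : matroid T) : {set T} := (mpair M).1.
Definition bases (T : finType) (M : matroid T) : {set {set T}} := (mpair M).2.

Section MatroidNotions.
Context {T : finType}.
Implicit Types (M : matroid T) (A B C F H I J S : {set T}).

Definition indep M I : bool := [exists B in bases M, I \subset B].

Definition circuit M C : bool :=
  [&& C \subset ground M, ~~ indep M C &
      [forall I : {set T}, (I \proper C) ==> indep M I]].

(* Equals the size of a largest independent subset of A. *)
Definition rk M A : nat := \max_(B in bases M) #|B :&: A|.

Definition rank M : nat := rk M (ground M).

Definition flat M F : bool :=
  (F \subset ground M) &&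
  [forall x in ground M :\: F, rk M F < rk M (x |: F)].

Definition hyperplane M H : bool := flat M H && ((rk M H).+1 == rank M).

Definition stressed_hyperplane M H : bool :=
  hyperplane M H &&
  [forall S : {set T}, (S \subset H) && (#|S| == rank M) ==> circuit M S].

End MatroidNotions.

Lemma eq_matroid (T : finType) (M N : matroid T) :
  ground M = ground N -> bases M = bases N -> M = N.
Proof.
rewrite /ground /bases => e1 e2; apply: val_inj => /=.
by move: e1 e2; case: (mpair M) (mpair N) => ? ? [? ?] /= -> ->.
Qed.

Section BasicTheory.
Context {T : finType}.
Implicit Types (M : matroid T) (A B C F H I J S : {set T}).

Lemma matroid_axiom M :
  [&& bases M != set0, [forall B in bases M, B \subset ground M]
    & base_exchange (bases M)].
Proof. by rewrite /bases /ground; case: M => -[]. Qed.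

Lemma bases_ex M : exists B, B \in bases M.
Proof. by case/and3P: (matroid_axiom M) => /set0Pn. Qed.

Lemma bases_sub M B : B \in bases M -> B \subset ground M.
Proof. by case/and3P: (matroid_axiom M) => _ /forall_inP h _; apply: h. Qed.

Lemma bases_exch M B1 B2 x : B1 \in bases M -> B2 \in bases M ->
  x \in B1 -> x \notin B2 ->
  exists y, [/\ y \in B2, y \notin B1 & (y |: B1 :\ x) \in bases M].
Proof.
case/and3P: (matroid_axiom M) => _ _ /forall_inP h h1 h2 x1 x2.
have xD : x \in B1 :\: B2 by rewrite inE x1 x2.
move/forall_inP: (h _ h1) => /(_ _ h2) /forall_inP /(_ _ xD) /exists_inP[y].
by rewrite inE => /andP[y1 y2] h3; exists y.
Qed.

Lemma bases_card_le M B1 B2 : B1 \in bases M -> B2 \in bases M -> #|B1| <= #|B2|.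
Proof.
have [n] := ubnP #|B1 :\: B2|; elim: n B1 => // n IH B1 ltn h1 h2.
have [/eqP|[x]] := set_0Vmem (B1 :\: B2).
  by rewrite setD_eq0 => /subset_leq_card.
rewrite inE => /andP[x2 x1].
have [y [y2 y1 h3]] := bases_exch h1 h2 x1 x2.
have -> : #|B1| = #|y |: B1 :\ x|.
  by rewrite cardsU1 !inE negb_and y1 orbT (cardsD1 x B1) x1.
apply: IH => //; rewrite ltnS in ltn; apply: leq_trans ltn; apply: proper_card.
apply/properP; split; last by exists x; rewrite !inE ?x1 ?x2 // eqxx /= orbF;
  case: eqP => //= e; rewrite e y2 in x2.
by apply/subsetP=> z; rewrite !inE; case: eqP => [->|_] /=; [rewrite y2|];
  case: (z \in B2) => //= /andP[].
Qed.

Lemma bases_card M B1 B2 : B1 \in bases M -> B2 \in bases M -> #|B1| = #|B2|.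
Proof. by move=> h1 h2; apply/eqP; rewrite eqn_leq !(@bases_card_le M). Qed.

Lemma indepP M I : reflect (exists2 B, B \in bases M & I \subset B) (indep M I).
Proof. exact: exists_inP. Qed.

Lemma indep_sub M I J : indep M J -> I \subset J -> indep M I.
Proof. by case/indepP=> B hB JB IJ; apply/indepP; exists B => //; apply: subset_trans JB. Qed.

Lemma indep_ground M I : indep M I -> I \subset ground M.
Proof. by case/indepP=> B /bases_sub h IB; apply: subset_trans h. Qed.

Lemma indep_aug M I J : indep M I -> indep M J -> #|I| < #|J| ->
  exists x, [/\ x \in J, x \notin I & indep M (x |: I)].
Proof.
move=> /indepP[B1 h1 IB] /indepP[B2' h2' JB2'] ltIJ.
have [B2 [h2 JB2 B2D]] : exists B2, [/\ B2 \in bases M, J \subset B2 & B2 :\: B1 \subset J].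
  have [n] := ubnP #|B2' :\: (J :|: B1)|; elim: n B2' h2' JB2' => // n IH B2 h2 JB2 ltn.
  have [/eqP|[x]] := set_0Vmem (B2 :\: (J :|: B1)).
    rewrite setD_eq0 => h; exists B2; split=> //; apply/subsetP=> z.
    by rewrite inE => /andP[z1 z2]; move/subsetP: h => /(_ _ z2); rewrite inE (negPf z1) orbF.
  rewrite !inE negb_or -andbA => /and3P[xJ x1 x2].
  have [y [y1 y2 h3]] := bases_exch h2 h1 x2 x1.
  apply: (IH _ h3).
    apply/subsetP=> z zJ; rewrite !inE (subsetP JB2 _ zJ) andbT.
    by rewrite orbC; case: eqP => // e; rewrite -e zJ in xJ.
  rewrite ltnS in ltn; apply: leq_trans ltn; apply: proper_card; apply/properP; split; last first.
    exists x; rewrite !inE ?(negPf xJ) ?(negPf x1) ?x2 //= eqxx /= orbF.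
    by case: eqP => // e; rewrite e y1 in x1.
  apply/subsetP=> z; rewrite !inE; case: eqP => [->|_] /=; first by rewrite y1 orbT.
  by case/andP=> -> /andP[].
have [B1' [h1' IB1' [B1D|[y yJ]]]] : exists B1', [/\ B1' \in bases M, I \subset B1' &
     ((B1' :\: B2 \subset I) /\ (B2 :\: B1' \subset J)) \/ exists2 y, y \in J & (y \notin I) /\ indep M (y |: I)].
  have [/eqP|[x]] := set_0Vmem (B1 :\: (I :|: B2)).
    rewrite setD_eq0 => h; exists B1; split=> //; left; split=> //; apply/subsetP=> z.
    by rewrite inE => /andP[z1 z2]; move/subsetP: h => /(_ _ z2); rewrite inE (negPf z1) orbF.
  rewrite !inE negb_or -andbA => /and3P[xI x2 x1].
  have [y [y2 y1 h3]] := bases_exch h1 h2 x1 x2.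
  exists B1; split=> //; right; exists y.
    by apply: (subsetP B2D); rewrite inE y1 y2.
  split; first by apply: contra y1; apply: (subsetP IB).
  apply/indepP; exists (y |: B1 :\ x) => //; apply: setUS; apply/subsetP=> z zI.
  by rewrite !inE (subsetP IB _ zI) andbT; case: eqP => // e; rewrite -e zI in xI.
- case: B1D => B1D B2D'.
  have [|[x]] := set_0Vmem ((J :&: B1') :\: I); last first.
    rewrite !inE => /and3P[xI xJ x1]; exists x; split=> //.
    by apply/indepP; exists B1' => //; rewrite subUset sub1set x1.
  move/eqP; rewrite setD_eq0 => JI; exfalso.
  have e := bases_card h1' h2.
  have := cardsID B2 B1'; have := cardsID B1' B2; rewrite setIC e => <- eD.
  have := cardsID B1' J; have := cardsID B2 I => eI eJ.
  have l1 : #|J :&: B1'| <= #|I :&: B2|.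
    apply/subset_leq_card/subsetP=> z zz; rewrite inE (subsetP JI _ zz).
    by apply: (subsetP JB2); move: zz; rewrite inE => /andP[].
  have l2 : #|J :\: B1'| <= #|B2 :\: B1'| by apply/subset_leq_card/setSD.
  have l3 : #|B1' :\: B2| <= #|I :\: B2|.
    apply/subset_leq_card/subsetP=> z zz; rewrite inE (subsetP B1D _ zz) andbT.
    by move: zz; rewrite inE => /andP[].
  by lia.
- by case=> yI h; exists y.
Qed.

Lemma rk_ge M A B : B \in bases M -> #|B :&: A| <= rk M A.
Proof.
exact: (@leq_bigmax_cond _ (fun B => B \in bases M) (fun B => #|B :&: A|)).
Qed.

Lemma indep_rk M I A : indep M I -> I \subset A -> #|I| <= rk M A.
Proof.
case/indepP=> B hB IB IA; apply: leq_trans (rk_ge A hB).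
by apply: subset_leq_card; rewrite subsetI IB.
Qed.

Lemma rk_ex M A : exists I, [/\ indep M I, I \subset A & #|I| = rk M A].
Proof.
have [B0 hB0] := bases_ex M.
have h : 0 < #|bases M| by apply/card_gt0P; exists B0.
have [B hB e] := eq_bigmax_cond (fun B : {set T} => #|B :&: A|) h.
exists (B :&: A); split; [|exact: subsetIr|by rewrite -e].
by apply/indepP; exists B => //; apply: subsetIl.
Qed.

Lemma indep_ext M I A : indep M I -> I \subset A ->
  exists J, [/\ indep M J, I \subset J, J \subset A & #|J| = rk M A].
Proof.
have [K [hK KA eK]] := rk_ex M A.
have [n] := ubnP (rk M A - #|I|); elim: n I => // n IH I ltn hI IA.
have := indep_rk hI IA; rewrite leq_eqVlt => /orP[/eqP e|lt].
  by exists I.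
have [x [xK xI hx]] := indep_aug hI hK (leq_trans lt (eq_leq (esym eK))).
have [||J [hJ IJ JA eJ]] := IH (x |: I) _ hx.
- by rewrite cardsU1 xI /=; lia.
- by rewrite subUset sub1set (subsetP KA).
by exists J; split=> //; apply: subset_trans IJ; apply: subsetUr.
Qed.

Lemma rk_card M A : rk M A <= #|A|.
Proof. by have [I [_ /subset_leq_card IA <-]] := rk_ex M A. Qed.

Lemma rkS M A B : A \subset B -> rk M A <= rk M B.
Proof.
by move=> AB; have [I [hI IA <-]] := rk_ex M A; apply: indep_rk => //; apply: subset_trans AB.
Qed.

Lemma rk_submod M A B : rk M (A :|: B) + rk M (A :&: B) <= rk M A + rk M B.
Proof.
have [I [hI IA eI]] := rk_ex M (A :&: B).
have [J [hJ IJ JA eJ]] := indep_ext hI (subset_trans IA (subset_trans (subsetIl A B) (subsetUl A B))).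
have l1 : #|J :&: A| <= rk M A by apply: indep_rk; [apply: indep_sub hJ _; apply: subsetIl|apply: subsetIr].
have l2 : #|J :&: B| <= rk M B by apply: indep_rk; [apply: indep_sub hJ _; apply: subsetIl|apply: subsetIr].
have l3 : #|I| <= #|J :&: A :&: (J :&: B)|.
  apply: subset_leq_card; apply/subsetP=> x xI; rewrite !inE (subsetP IJ _ xI) /=.
  by move: (subsetP IA _ xI); rewrite inE.
have := cardsUI (J :&: A) (J :&: B); rewrite -setIUr (setIidPl JA).
lia.
Qed.

Lemma rkIg M A : rk M (A :&: ground M) = rk M A.
Proof.
apply/eqP; rewrite eqn_leq rkS ?subsetIl //=.
have [I [hI IA <-]] := rk_ex M A; apply: indep_rk => //.
by rewrite subsetI IA indep_ground.
Qed.

Lemma indepE M I : indep M I = (#|I| == rk M I).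
Proof.
apply/idP/eqP=> [hI|e]; first by apply/eqP; rewrite eqn_leq rk_card andbT indep_rk.
have [J [hJ JI eJ]] := rk_ex M I.
have /eqP <- // : J == I by rewrite eqEcard JI eJ e leqnn.
Qed.

Lemma basesE M B : (B \in bases M) = [&& B \subset ground M, indep M B & #|B| == rank M].
Proof.
apply/idP/and3P=> [hB|[_ /indepP[B' hB' BB'] /eqP e]].
  have iB : indep M B by apply/indepP; exists B.
  split; [exact: bases_sub|by []|].
  rewrite eqn_leq indep_rk ?bases_sub //= /rank.
  have [J [/indepP[B' hB' JB'] _ <-]] := rk_ex M (ground M).
  by rewrite (bases_card hB hB') subset_leq_card.
have /eqP -> // : B == B'.
rewrite eqEcard BB' e /rank; apply: indep_rk; last exact: bases_sub.
by apply/indepP; exists B'.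
Qed.

End BasicTheory.

Section OfRank.
Context {T : finType}.
Variables (E : {set T}) (r : {set T} -> nat).
Implicit Types (A B I J : {set T}).
Hypothesis r_card : forall A, r A <= #|A|.
Hypothesis rS : forall A B, A \subset B -> r A <= r B.
Hypothesis r_submod : forall A B, r (A :|: B) + r (A :&: B) <= r A + r B.

Definition rank_bases : {set {set T}} :=
  [set I : {set T} | [&& I \subset E, #|I| == r I & r I == r E]].

Lemma r_add A (S : {set T}) : (forall y, y \in S -> r (y |: A) = r A) -> r (A :|: S) = r A.
Proof.
have [n] := ubnP #|S|; elim: n S => // n IH S ltn h.
have [->|[y yS]] := set_0Vmem S; first by rewrite setU0.
have e : r (A :|: (S :\ y)) = r A.
  apply: IH => [|z]; first by move: ltn; rewrite (cardsD1 y) yS; lia.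
  by rewrite inE => /andP[_ /h].
have := r_submod (A :|: (S :\ y)) (y |: A); rewrite e (h _ yS).
have -> : A :|: S :\ y :|: (y |: A) = A :|: S.
  by apply/setP=> z; rewrite !inE; case: eqP => [->|_] /=; [rewrite yS !orbT|];
    case: (z \in A); rewrite ?orbT ?orbF.
have l1 : r A <= r ((A :|: S :\ y) :&: (y |: A)).
  by apply: rS; rewrite subsetI subsetUl subsetUr.
have l2 : r A <= r (A :|: S) by apply: rS; apply: subsetUl.
lia.
Qed.

Lemma r_sub I J : #|J| = r J -> I \subset J -> #|I| = r I.
Proof.
move=> e IJ; have := r_submod I (J :\: I); have := r_card I; have := r_card (J :\: I).
have -> : I :|: (J :\: I) = J by rewrite setUC setDE setUIl [~: I :|: I]setUC setUCr setIT; apply/setUidPl.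
by have := cardsID I J; rewrite (setIidPr IJ); lia.
Qed.

Lemma r_ext I A : #|I| = r I -> I \subset A ->
  exists J, [/\ #|J| = r J, I \subset J, J \subset A & r J = r A].
Proof.
have [n] := ubnP (#|A| - #|I|); elim: n I => // n IH I ltn hI IA.
have [/existsP[y /andP[yA]]|] := boolP [exists y, (y \in A) && (r (y |: I) != r I)].
  move=> ne.
  have yI : y \notin I.
    by apply: contra ne => yI; rewrite (setUidPr _) // sub1set.
  have l1 : r I <= r (y |: I) by apply: rS; apply: subsetUr.
  have l2 := r_card (y |: I); have c : #|y |: I| = #|I|.+1 by rewrite cardsU1 yI.
  have yIA : y |: I \subset A by rewrite subUset sub1set yA.
  have [|||J [a b c' d]] := IH (y |: I).
  - by have := subset_leq_card yIA; lia.
  - by move/eqP: ne; lia.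
  - by [].
  by exists J; split=> //; apply: subset_trans b; apply: subsetUr.
rewrite negb_exists => /forallP h; exists I; split=> //.
rewrite -[in RHS](setUidPr IA); apply/esym/r_add => y yA.
by move: (h y); rewrite yA /= negbK => /eqP.
Qed.

Lemma r0 : r set0 = 0.
Proof. by apply/eqP; rewrite -leqn0 -(cards0 T). Qed.

Lemma rank_is_matroid : is_matroid (E, rank_bases).
Proof.
apply/and3P; split=> /=.
- have [||J [a b c d]] := @r_ext set0 E; rewrite ?cards0 ?r0 ?sub0set //.
  by apply/set0Pn; exists J; rewrite inE a c d !eqxx.
- by apply/forall_inP=> B; rewrite inE => /andP[].
apply/forall_inP=> B1; rewrite inE => /and3P[s1 /eqP c1 /eqP r1].
apply/forall_inP=> B2; rewrite inE => /and3P[s2 /eqP c2 /eqP r2].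
apply/forall_inP=> x; rewrite inE => /andP[x2 x1].
have c0 : #|B1 :\ x| = r (B1 :\ x) by apply: (r_sub c1); apply: subsetDl.
have [/existsP[y /andP[yA ne]]|] := boolP [exists y, (y \in B2) && (r (y |: B1 :\ x) != r (B1 :\ x))].
  have yx : y != x by apply: contraNneq x2 => <-.
  have y1 : y \notin B1.
    by apply: contra ne => y1; rewrite (setUidPr _) // sub1set !inE yx.
  apply/exists_inP; exists y; first by rewrite inE y1 yA.
  have l1 : r (B1 :\ x) <= r (y |: B1 :\ x) by apply: rS; apply: subsetUr.
  have l2 := r_card (y |: B1 :\ x); have c : #|y |: B1 :\ x| = #|B1 :\ x|.+1.
    by rewrite cardsU1 !inE negb_and y1 orbT.
  have c' : #|B1| = #|B1 :\ x|.+1 by rewrite (cardsD1 x) x1.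
  rewrite inE subUset sub1set (subsetP s2 _ yA) (subset_trans (subsetDl _ _) s1) /=.
  by move/eqP: ne => ne; apply/andP; split; apply/eqP; lia.
rewrite negb_exists => /forallP h; exfalso.
have e : r (B1 :\ x :|: B2) = r (B1 :\ x).
  by apply: r_add => y yA; move: (h y); rewrite yA /= negbK => /eqP.
have l : r B2 <= r (B1 :\ x :|: B2) by apply: rS; apply: subsetUr.
have c' : #|B1| = #|B1 :\ x|.+1 by rewrite (cardsD1 x) x1.
lia.
Qed.

Lemma rk_rank_bases (M : matroid T) A :
  bases M = rank_bases -> A \subset E -> rk M A = r A.
Proof.
move=> eM AE; apply/eqP; rewrite eqn_leq; apply/andP; split.
  apply/bigmax_leqP=> B; rewrite eM inE => /and3P[_ /eqP c _].
  by rewrite (r_sub c) ?subsetIl // rS ?subsetIr.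
have [||I [a _ c d]] := @r_ext set0 A; rewrite ?cards0 ?r0 ?sub0set //.
have [J [a' b' c' d']] := r_ext a (subset_trans c AE).
have hJ : J \in bases M by rewrite eM inE c' a' d' !eqxx.
apply: leq_trans (rk_ge A hJ).
by rewrite -d -a; apply: subset_leq_card; rewrite subsetI b'.
Qed.

End OfRank.

Section Minors.
Context {T : finType}.
Implicit Types (M N : matroid T) (A B C F G H I J S : {set T}).

Lemma eq_matroid_rk M N : ground M = ground N ->
  (forall A, A \subset ground M -> rk M A = rk N A) -> M = N.
Proof.
move=> eg er; apply: eq_matroid => //; apply/setP=> B; rewrite !basesE !indepE -eg.
have [s|] //= := boolP (B \subset ground M).
by rewrite (er _ s) /rank (er (ground M)) ?eg.
Qed.

Definition localization_sets M F : {set T} * {set {set T}} :=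
  (F, [set I : {set T} | [&& I \subset F, indep M I & #|I| == rk M F]]).

Fact localization_is_matroid M F : is_matroid (localization_sets M F).
Proof.
have := rank_is_matroid F (rk_card M) (@rkS _ M) (rk_submod M).
congr (is_matroid (_, _)); apply/setP=> I; rewrite !inE indepE.
by case: eqP => [->|] //=.
Qed.

(* The restriction M|F. For a flat F its flats are those of M inside F, see
   [flat_localization]. *)
Definition localization M F : matroid T := Matroid (localization_is_matroid M F).

Definition contraction_sets M F : {set T} * {set {set T}} :=
  (ground M :\: F,
   [set I : {set T} | [&& I \subset ground M :\: F, #|I| + rk M F == rank M
                        & rk M (I :|: F) == rank M]]).

Let r M F A := rk M (A :|: F) - rk M F.

Let r_card M F A : r M F A <= #|A|.
Proof. by rewrite /r; have := rk_submod M A F; have := rk_card M A; lia. Qed.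

Let rS M F A B : A \subset B -> r M F A <= r M F B.
Proof. by move=> AB; rewrite /r leq_sub2r // rkS // setSU. Qed.

Let r_submod M F A B : r M F (A :|: B) + r M F (A :&: B) <= r M F A + r M F B.
Proof.
rewrite /r; have := rk_submod M (A :|: F) (B :|: F).
have -> : A :|: F :|: (B :|: F) = A :|: B :|: F by rewrite setUACA setUid.
rewrite -setUIl.
have l X : rk M F <= rk M (X :|: F) by rewrite rkS // subsetUr.
by have := l A; have := l B; have := l (A :|: B); have := l (A :&: B); lia.
Qed.

Let rk_groundU M F : rk M (ground M :\: F :|: F) = rank M.
Proof.
rewrite -rkIg; congr rk; apply/setP=> z; rewrite !inE.
by case: (z \in F); case: (z \in ground M).
Qed.

Lemma rk_le_rank M A : rk M A <= rank M.
Proof. by rewrite -rkIg rkS // subsetIr. Qed.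

Let contraction_bases M F :
  (contraction_sets M F).2 = rank_bases (ground M :\: F) (r M F).
Proof.
apply/setP=> I; rewrite !inE /r rk_groundU.
have := rk_le_rank M F; have := @rkS _ M F (I :|: F) (subsetUr _ _).
have := rk_le_rank M (I :|: F).
by case: (_ \subset _) => //= l1 l2 l3; apply/andP/andP=> -[/eqP e1 /eqP e2];
  split; apply/eqP; lia.
Qed.

Fact contraction_is_matroid M F : is_matroid (contraction_sets M F).
Proof.
have := rank_is_matroid (ground M :\: F) (@r_card M F) (@rS M F) (@r_submod M F).
by rewrite -contraction_bases.
Qed.

(* M/F; its flats are the F' :\: F for F' a flat of M containing F, see
   [flat_contraction]. *)
Definition contraction M F : matroid T := Matroid (contraction_is_matroid M F).

Lemma rk_localization M F A : A \subset F -> rk (localization M F) A = rk M A.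
Proof.
apply: (rk_rank_bases (rk_card M) (@rkS _ M) (rk_submod M)).
by apply/setP=> I; rewrite !inE indepE; case: eqP => [->|] //=.
Qed.

Lemma rk_contraction M F A : A \subset ground M :\: F ->
  rk (contraction M F) A = rk M (A :|: F) - rk M F.
Proof.
apply: (rk_rank_bases (@r_card M F) (@rS M F) (@r_submod M F)).
exact: contraction_bases.
Qed.

Lemma ground_localization M F : ground (localization M F) = F. Proof. by []. Qed.
Lemma ground_contraction M F : ground (contraction M F) = ground M :\: F.
Proof. by []. Qed.

Lemma rank_localization M F : rank (localization M F) = rk M F.
Proof. exact: rk_localization. Qed.

Lemma rank_contraction M F : rank (contraction M F) = rank M - rk M F.
Proof. by rewrite /rank rk_contraction // rk_groundU. Qed.

Lemma flatP M F : reflect (F \subset ground M /\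
    forall x, x \in ground M -> x \notin F -> rk M F < rk M (x |: F)) (flat M F).
Proof.
apply: (iffP andP) => -[s h]; split=> //.
  by move=> x xg xF; move/forall_inP: h; apply; rewrite inE xF.
by apply/forall_inP=> x; rewrite inE => /andP[xF xg]; apply: h.
Qed.

Lemma flat_sub M F : flat M F -> F \subset ground M. Proof. by case/andP. Qed.

Lemma flat_ground M : flat M (ground M).
Proof. by apply/flatP; split=> // x ->. Qed.

Lemma flat_localization M F G : flat M F ->
  flat (localization M F) G = flat M G && (G \subset F).
Proof.
move=> /flatP[sF hF]; apply/flatP/andP=> [[s h]|[/flatP[s h] GF]]; last first.
  split=> // x xF xG; rewrite !rk_localization ?subUset ?sub1set ?xF //.
  by apply: h => //; apply: (subsetP sF).
rewrite /= ground_localization in s h; split=> //; apply/flatP; split.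
  exact: subset_trans sF.
move=> x xg xG; have [xF|xF] := boolP (x \in F).
  by have := h _ xF xG; rewrite !rk_localization ?subUset ?sub1set ?xF.
have := hF _ xg xF; have := rk_submod M (x |: G) F.
have -> : x |: G :|: F = x |: F by rewrite -setUA (setUidPr s).
have : rk M G <= rk M ((x |: G) :&: F) by rewrite rkS // subsetI subsetUr.
lia.
Qed.

Lemma flat_contraction M F G : F \subset ground M -> G \subset ground M :\: F ->
  flat (contraction M F) G = flat M (G :|: F).
Proof.
move=> sF sG; have sGg : G \subset ground M by apply: subset_trans sG (subsetDl _ _).
have l A : rk M F <= rk M (A :|: F) by rewrite rkS // subsetUr.
apply/flatP/flatP=> -[s h]; split=> //; rewrite ?subUset ?sGg //.
  move=> x xg; rewrite inE negb_or => /andP[xG xF].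
  have xD : x \in ground M :\: F by rewrite inE xF.
  have := h _ xD xG; rewrite !rk_contraction ?subUset ?sub1set ?xD // setUA.
  by have := l G; have := l (x |: G); lia.
move=> x xD xG; have := xD; rewrite inE => /andP[xF xg].
rewrite !rk_contraction ?subUset ?sub1set ?xD //.
have := h x xg; rewrite inE negb_or xG xF => /(_ isT).
by have := l G; have := l (x |: G); rewrite setUA; lia.
Qed.

Lemma contraction0 M : contraction M set0 = M.
Proof.
have r0M : rk M set0 = 0 by apply/eqP; rewrite -leqn0 -(cards0 T) rk_card.
apply: eq_matroid_rk => [|A sA]; first by rewrite ground_contraction setD0.
by rewrite rk_contraction // setU0 r0M subn0.
Qed.

Lemma localizationT M : localization M (ground M) = M.
Proof. by apply: eq_matroid_rk => // A sA; rewrite rk_localization. Qed.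

Lemma localizationK M F G : F \subset G ->
  localization (localization M G) F = localization M F.
Proof.
move=> FG; apply: eq_matroid_rk => // A sA.
by rewrite !rk_localization // (subset_trans sA).
Qed.

Lemma localization_contraction M F G : F \subset G -> G \subset ground M ->
  localization (contraction M F) (G :\: F) = contraction (localization M G) F.
Proof.
move=> FG sG; apply: eq_matroid_rk => // A sA.
rewrite ground_localization in sA.
have sAg : A \subset ground M :\: F by apply: subset_trans sA _; apply: setSD.
have AG : A \subset G by apply: subset_trans sA _; apply: subsetDl.
rewrite rk_localization // !rk_contraction // !rk_localization //.
by rewrite subUset AG.
Qed.

Lemma contractionK M F G : F \subset G -> G \subset ground M ->
  contraction (contraction M F) (G :\: F) = contraction M G.
Proof.
move=> FG sG.
have e : ground M :\: F :\: (G :\: F) = ground M :\: G.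
  apply/setP=> z; rewrite !inE; case: (boolP (z \in F)) => [/(subsetP FG) ->|] //=.
apply: eq_matroid_rk => [|A sA]; first by rewrite !ground_contraction.
rewrite !ground_contraction e in sA.
have sAF : A \subset ground M :\: F by apply: subset_trans sA _; apply: setDS.
rewrite !rk_contraction ?ground_contraction ?e ?subUset ?sAF ?setSD //.
have -> : G :\: F :|: F = G.
  apply/setP=> z; rewrite !inE; case: (boolP (z \in F)) => [/(subsetP FG) ->|] //=.
  by rewrite orbF.
have -> : A :|: G :\: F :|: F = A :|: G.
  apply/setP=> z; rewrite !inE; case: (boolP (z \in F)) => [/(subsetP FG) ->|] //=.
    by rewrite !orbT.
  by rewrite orbF.
have := @rkS _ M _ _ FG; have := @rkS _ M G (A :|: G) (subsetUr _ _).
lia.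
Qed.

End Minors.

Section Relaxation.
Context {T : finType}.
Implicit Types (M : matroid T) (H S B A : {set T}).

Definition relaxation_sets M H : {set T} * {set {set T}} :=
  (ground M, bases M :|: [set S : {set T} | S \subset H & #|S| == rank M]).

Fact relaxation_is_matroid M H :
  stressed_hyperplane M H -> is_matroid (relaxation_sets M H).
Proof.
move=> /andP[/andP[/flatP[sH hH] /eqP rH] /forallP st].
have cS S : S \subset H -> #|S| = rank M ->
    forall x, x \in S -> indep M (S :\ x) /\ rk M (S :\ x) = rk M H.
  move=> SH cS x xS.
  have := st S; rewrite SH cS eqxx => /and3P[_ _ /forallP /(_ (S :\ x))].
  rewrite properD1 //= => h; split=> //; move: h; rewrite indepE => /eqP <-.
  by move: cS; rewrite (cardsD1 x) xS; lia.
have up A y : A \subset H -> rk M A = rk M H -> y \in ground M -> y \notin H ->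
    rank M <= rk M (y |: A).
  move=> AH rA yg yH; have := rk_submod M H (y |: A); have := hH _ yg yH.
  have -> : H :|: (y |: A) = y |: H by rewrite setUCA (setUidPl AH).
  have : rk M A <= rk M (H :&: (y |: A)) by rewrite rkS // subsetI AH subsetUr.
  lia.
apply/and3P; split=> /=.
- by have [B hB] := bases_ex M; apply/set0Pn; exists B; rewrite inE hB.
- apply/forall_inP=> B; rewrite !inE => /orP[/bases_sub //|/andP[BH _]].
  exact: subset_trans sH.
apply/forall_inP=> B1 h1; apply/forall_inP=> B2 h2; apply/forall_inP=> x.
rewrite inE => /andP[x2 x1].
have c B : B \in bases M :|: [set S : {set T} | S \subset H & #|S| == rank M] -> #|B| = rank M.
  rewrite !inE => /orP[|/andP[_ /eqP //]].
  by rewrite basesE => /and3P[_ _ /eqP].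
have c1 := c _ h1; have c2 := c _ h2.
have cx : #|B1 :\ x|.+1 = rank M by rewrite -c1 (cardsD1 x B1) x1.
have cy y : y \notin B1 -> #|y |: B1 :\ x| = rank M.
  by move=> y1; rewrite cardsU1 !inE negb_and y1 orbT -cx.
have inB y : y \in ground M -> y \notin B1 -> B1 :\ x \subset ground M ->
    rank M <= rk M (y |: B1 :\ x) -> y |: B1 :\ x \in bases M.
  move=> yg y1 sB l; rewrite basesE indepE cy // subUset sub1set yg sB /= eqxx andbT.
  by rewrite eqn_leq l rk_le_rank.
move: h1 h2; rewrite !inE => /orP[b1|/andP[s1 _]] /orP[b2|/andP[s2 _]].
- have [y [y2 y1 h]] := bases_exch b1 b2 x1 x2.
  by apply/exists_inP; exists y; rewrite !inE ?y1 ?y2 ?h.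
- have [sB1|nB1] := boolP (B1 :\ x \subset H).
    have [y y2 y1] : exists2 y, y \in B2 & y \notin B1.
      have : ~~ (B2 \subset B1).
        apply/negP=> s; have /eqP e : B2 == B1 by rewrite eqEcard s c1 c2 leqnn.
        by rewrite e x1 in x2.
      by case/subsetPn=> y; exists y.
    apply/exists_inP; exists y; first by rewrite !inE y1.
    by rewrite !inE subUset sub1set (subsetP s2 _ y2) sB1 cy // eqxx orbT.
  have sg := bases_sub b1.
  have iB : rk M (B1 :\ x) = #|B1 :\ x|.
    have : indep M (B1 :\ x) by apply/indepP; exists B1 => //; apply: subsetDl.
    by rewrite indepE => /eqP.
  have [/existsP[y /andP[yA ne]]|] :=
      boolP [exists y, (y \in B2) && (rk M (y |: B1 :\ x) != rk M (B1 :\ x))].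
    have yx : y != x by apply: contraNneq x2 => <-.
    have y1 : y \notin B1.
      by apply: contra ne => y1; rewrite (setUidPr _) // sub1set !inE yx.
    apply/exists_inP; exists y; first by rewrite !inE y1.
    rewrite !inE (inB y) // ?(subsetP sH) ?(subsetP s2) //.
      by apply: subset_trans sg; apply: subsetDl.
    have : rk M (B1 :\ x) <= rk M (y |: B1 :\ x) by rewrite rkS // subsetUr.
    by move/eqP: ne; lia.
  rewrite negb_exists => /forallP h; exfalso.
  have e : rk M (B1 :\ x :|: B2) = rk M (B1 :\ x).
    apply: (r_add (@rkS _ M) (rk_submod M)) => y yA.
    by move: (h y); rewrite yA /= negbK => /eqP.
  case/subsetPn: nB1 => a aB aH.
  have ag : a \in ground M by apply: (subsetP sg); move: aB; rewrite inE => /andP[].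
  have [s sB2] : exists s, s \in B2 by apply/set0Pn; rewrite -card_gt0 c2 -rH.
  have [_ rs] := cS _ s2 c2 _ sB2.
  have rB2 : rk M B2 = rk M H.
    by apply/eqP; rewrite eqn_leq rkS //= -rs rkS // subsetDl.
  have := up _ _ s2 rB2 ag aH.
  have : rk M (a |: B2) <= rk M (B1 :\ x :|: B2).
    by rewrite rkS // setSU // sub1set.
  lia.
- have [y y2 yH] : exists2 y, y \in B2 & y \notin H.
    have : ~~ (B2 \subset H).
      apply/negP=> /(@rkS _ M); move: b2; rewrite basesE indepE => /and3P[_ /eqP <- _].
      by rewrite c2; lia.
    by case/subsetPn=> y; exists y.
  have y1 : y \notin B1 by apply: contra yH; apply: (subsetP s1).
  have yg : y \in ground M by apply: (subsetP (bases_sub b2)).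
  have s1x : B1 :\ x \subset H by apply: subset_trans s1; apply: subsetDl.
  apply/exists_inP; exists y; first by rewrite !inE y1.
  rewrite !inE (inB y) //; first exact: subset_trans sH.
  by apply: up => //; case: (cS _ s1 c1 _ x1).
- have [y y2 y1] : exists2 y, y \in B2 & y \notin B1.
    have : ~~ (B2 \subset B1).
      apply/negP=> s; have /eqP e : B2 == B1 by rewrite eqEcard s c1 c2 leqnn.
      by rewrite e x1 in x2.
    by case/subsetPn=> y; exists y.
  apply/exists_inP; exists y; first by rewrite !inE y1.
  rewrite !inE subUset sub1set (subsetP s2 _ y2) cy // eqxx.
  by rewrite (subset_trans (subsetDl _ _) s1) orbT.
Qed.

Definition relaxation M H (sH : stressed_hyperplane M H) : matroid T :=
  Matroid (relaxation_is_matroid sH).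

End Relaxation.

Local Open Scope ring_scope.

(* t^n p(1/t), for p of degree at most n (see [revp_eval]). *)
Definition revp (n : nat) (p : {poly int}) : {poly int} :=
  \poly_(i < n.+1) p`_(n - i).

Section Revp.
Implicit Types (n : nat) (p q : {poly int}).

Lemma coef_revp n p i : (revp n p)`_i = if (i <= n)%N then p`_(n - i) else 0.
Proof. by rewrite coef_poly ltnS. Qed.

Fact revp_is_linear n : linear (revp n).
Proof.
move=> a p q; apply/polyP=> i; rewrite coefD coefZ !coef_revp.
by case: ifP => _; rewrite ?coefD ?coefZ // mulr0 addr0.
Qed.
HB.instance Definition _ n :=
  GRing.isLinear.Build int {poly int} {poly int} _ (revp n) (revp_is_linear n).

Lemma revpXn n i : (i <= n)%N -> revp n 'X^i = 'X^(n - i).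
Proof.
move=> h; apply/polyP=> j; rewrite coef_revp !coefXn.
by case: ifP => hj; [congr (_%:R : int); congr nat_of_bool|]; lia.
Qed.

Lemma size_revp n p : (size (revp n p) <= n.+1)%N.
Proof. exact: size_poly. Qed.

Lemma revpK n p : (size p <= n.+1)%N -> revp n (revp n p) = p.
Proof.
move=> h; apply/polyP=> i; rewrite !coef_revp leq_subr /=.
case: ifP => hi; first by rewrite subKn.
by rewrite nth_default //; apply: leq_trans h _; rewrite ltnNge hi.
Qed.

Lemma poly_sum n p : (size p <= n)%N -> p = \sum_(i < n) p`_i *: 'X^i.
Proof.
move=> h; rewrite -poly_def; apply/polyP=> i; rewrite coef_poly.
by case: ltnP => // hi; rewrite nth_default //; apply: leq_trans h hi.
Qed.

Lemma revpM a b p q : (size p <= a.+1)%N -> (size q <= b.+1)%N ->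
  revp (a + b) (p * q) = revp a p * revp b q.
Proof.
move=> hp hq; rewrite (poly_sum hp) (poly_sum hq) mulr_suml !linear_sum mulr_suml.
apply: eq_bigr => i _; rewrite !mulr_sumr !linear_sum; apply: eq_bigr => j _.
have hi : (i <= a)%N by rewrite -ltnS.
have hj : (j <= b)%N by rewrite -ltnS.
rewrite -scalerAl -scalerAr -exprD !linearZ /= !revpXn ?leq_add //.
rewrite -scalerAl -scalerAr -exprD; congr (_ *: (_ *: 'X^_)); lia.
Qed.

Lemma revp_eval (K : fieldType) n p (x : K) : (size p <= n.+1)%N -> x != 0 ->
  (map_poly intr (revp n p)).[x] = x ^+ n * (map_poly intr p).[x^-1].
Proof.
move=> h x0; rewrite (poly_sum h) linear_sum !rmorph_sum !horner_sum mulr_sumr.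
apply: eq_bigr => i _; rewrite linearZ /= revpXn -1?ltnS //.
rewrite -!mul_polyC !rmorphM /= !map_polyC /= !map_polyXn !hornerM !hornerC !hornerXn.
rewrite mulrCA; congr (_ * _); rewrite exprVn expfB_cond ?(negPf x0) //=.
by rewrite add0n -ltnS.
Qed.

End Revp.

Section CharPoly.
Context {T : finType}.
Implicit Types (M : matroid T) (A B F G : {set T}).

(* With this expansion chi M = 0 as soon as M has a loop ([chi_loop]). This is
   the convention under which the rank 0 clause of [KL_rank0] is compatible with
   [KL_equation]: if rank M = 0, the latter reads P M = chi M. *)
Definition chi M : {poly int} :=
  \sum_(A : {set T} | A \subset ground M) (-1) ^+ #|A| * 'X^(rank M - rk M A).

Lemma size_signXn (a n : nat) : size ((-1) ^+ a * 'X^n : {poly int}) = n.+1.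
Proof. by rewrite -signr_odd mulr_sign; case: odd; rewrite ?size_polyN size_polyXn. Qed.

Lemma size_chi M : (size (chi M) <= (rank M).+1)%N.
Proof.
apply: leq_trans (size_sum _ _ _) _; apply/bigmax_leqP=> A _.
by rewrite size_signXn ltnS leq_subr.
Qed.

Lemma revp_chi M : revp (rank M) (chi M) =
  \sum_(A : {set T} | A \subset ground M) (-1) ^+ #|A| * 'X^(rk M A).
Proof.
rewrite linear_sum /=; apply: eq_bigr => A _.
rewrite -signr_odd !mulr_sign (fun_if (revp _)) linearN /= revpXn ?leq_subr //.
by rewrite subKn // rk_le_rank.
Qed.

Lemma sum_toggle (h : {set T} -> {poly int}) A F x : x \in F -> x \notin A ->
  (forall B, A \subset B -> B \subset F -> x \notin B -> h (x |: B) = h B) ->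
  \sum_(B : {set T} | (A \subset B) && (B \subset F)) (-1) ^+ #|B| * h B = 0.
Proof.
move=> xF xA hh; rewrite (bigID (fun B => x \in B)) /=.
rewrite (reindex_onto (fun B => x |: B) (fun B => B :\ x)) /=; last first.
  by move=> B /andP[_ xB]; rewrite setD1K.
rewrite addrC (eq_bigr (fun B => (-1) ^+ #|B| * h B)) // addrC.
rewrite (eq_bigl (fun B => (A \subset B) && (B \subset F) && (x \notin B))); last first.
  move=> B /=; rewrite setU11 andbT subUset sub1set xF /=.
  have [xB|xB] := boolP (x \in B).
    rewrite !andbF; apply/negP=> /andP[_ /eqP e].
    by move: xB; rewrite -e !inE eqxx.
  rewrite setU1K // eqxx !andbT; congr (_ && _); apply/idP/idP=> s.
    apply/subsetP=> z zA; move/subsetP: s => /(_ _ zA); rewrite !inE.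
    by case: eqP => // e; rewrite -e zA in xA.
  by apply: subset_trans s _; apply: subsetUr.
rewrite -big_split big1 // => B /andP[/andP[AB BF] xB] /=.
by rewrite hh // cardsU1 xB /= exprS mulN1r mulNr addNr.
Qed.

Lemma chi_loop M x : x \in ground M -> rk M [set x] = 0%N -> chi M = 0.
Proof.
move=> xg rx; rewrite /chi.
rewrite (eq_bigl (fun A => (set0 \subset A) && (A \subset ground M))); last first.
  by move=> A; rewrite sub0set.
apply: (sum_toggle (x := x)); rewrite ?inE // => B _ _ _; congr ('X^(_ - _)).
have := rk_submod M [set x] B; have := @rkS _ M B (x |: B) (subsetUr _ _).
by rewrite rx; lia.
Qed.

Lemma chi_empty M : ground M = set0 -> chi M = 1.
Proof.
move=> e; rewrite /chi e (eq_bigl (pred1 set0)) ?big_pred1_eq; last first.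
  by move=> A; rewrite subset0.
by rewrite cards0 expr0 mul1r /rank e subnn.
Qed.

Lemma chi_contraction M A : A \subset ground M -> chi (contraction M A) =
  (-1) ^+ #|A| * \sum_(B : {set T} | (A \subset B) && (B \subset ground M))
     (-1) ^+ #|B| * 'X^(rank M - rk M B).
Proof.
move=> sA; rewrite mulr_sumr.
rewrite [RHS](reindex_onto (fun B => B :|: A) (fun B => B :\: A)) /=; last first.
  move=> B /andP[AB _]; apply/setP=> z; rewrite !inE.
  by case: (boolP (z \in A)) => [/(subsetP AB) ->|_] //=; rewrite orbF.
rewrite /chi ground_contraction.
have eP B : (B \subset ground M :\: A) =
    (A \subset B :|: A) && (B :|: A \subset ground M) && ((B :|: A) :\: A == B).
  rewrite subsetUr subUset sA andbT setDUl setDv setU0 subsetD /=.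
  congr (_ && _); rewrite eqEsubset subsetDl /= subsetD subxx /=.
  by rewrite disjoint_sym.
apply: eq_big => [B|B sB] //.
rewrite rank_contraction rk_contraction //.
have dBA : [disjoint B & A] by move: sB; rewrite subsetD => /andP[].
have -> : #|B :|: A| = (#|B| + #|A|)%N 
  by apply/eqP; case: (leq_card_setU B A) => _ ->.
rewrite exprD mulrA [_ * ((-1) ^+ #|B| * _)]mulrCA -expr2 sqrr_sign mulr1.
congr (_ * 'X^_); have := @rkS _ M A (B :|: A) (subsetUr _ _).
have := rk_le_rank M (B :|: A); lia.
Qed.

Lemma sum_sign A F : A \subset F ->
  \sum_(B : {set T} | (A \subset B) && (B \subset F)) (-1) ^+ #|B| =
  (if A == F then (-1) ^+ #|A| else 0) :> {poly int}.
Proof.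
move=> AF; case: eqP => [->|ne].
  by rewrite (eq_bigl (pred1 F)) ?big_pred1_eq // => B; rewrite andbC -eqEsubset.
have [x xF xA] : exists2 x, x \in F & x \notin A.
  by apply/subsetPn; apply/negP=> FA; apply: ne; apply/eqP; rewrite eqEsubset AF.
rewrite -[RHS](sum_toggle (h := fun=> 1) xF xA) //.
by apply: eq_bigr => B _; rewrite mulr1.
Qed.

Lemma chi_contraction_nonflat M A : A \subset ground M -> ~~ flat M A ->
  chi (contraction M A) = 0.
Proof.
move=> sA; rewrite /flat sA /= => /forallPn[x]; rewrite negb_imply -leqNgt.
case/andP=> xD l.
apply: (chi_loop (x := x)); first by rewrite ground_contraction.
by rewrite rk_contraction ?sub1set //; apply/eqP; rewrite subn_eq0.
Qed.

(* the flats above A, weighted by the characteristic polynomials of the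
   contractions, recover X^(corank A): Moebius inversion on the Boolean lattice *)
Lemma sum_chi_contraction M A : A \subset ground M ->
  \sum_(F | flat M F && (A \subset F)) chi (contraction M F) = 'X^(rank M - rk M A).
Proof.
have [n] := ubnP (#|ground M| - #|A|); elim: n A => // n IH A ltn sA.
set S := fun B : {set T} => \sum_(F | flat M F && (B \subset F)) chi (contraction M F).
have e1 : \sum_(B : {set T} | (A \subset B) && (B \subset ground M)) (-1) ^+ #|B| * S B
       = (-1) ^+ #|A| * chi (contraction M A).
  under eq_bigr do rewrite mulr_sumr.
  rewrite (exchange_big_dep (fun F => flat M F && (A \subset F))) /=; last first.
    by move=> B F /andP[AB _] /andP[-> BF]; apply: subset_trans BF.
  have -> : (-1) ^+ #|A| * chi (contraction M A) =
      \sum_(F | flat M F && (A \subset F)) (if A == F then (-1) ^+ #|A| else 0) * chi (contraction M F).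
    have [fA|nfA] := boolP (flat M A).
      rewrite (bigD1 A) ?fA ?subxx //= eqxx big1 ?addr0 // => F /andP[_ ne].
      by rewrite eq_sym (negPf ne) mul0r.
    rewrite chi_contraction_nonflat // mulr0 big1 // => F /andP[fF _].
    by case: eqP => [e|]; rewrite ?mul0r //; rewrite e fF in nfA.
  apply: eq_bigr => F /andP[fF AF]; rewrite -sum_sign // mulr_suml.
  apply: eq_bigl => B; rewrite fF /= andbAC -andbA.
  case: (A \subset B) => //=; apply: andb_idr => BF.
  by apply: subset_trans BF _; apply: flat_sub.
have e2 := chi_contraction sA.
have : \sum_(B : {set T} | (A \subset B) && (B \subset ground M)) (-1) ^+ #|B| * S B
     = \sum_(B : {set T} | (A \subset B) && (B \subset ground M)) (-1) ^+ #|B| * 'X^(rank M - rk M B).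
  by rewrite e1 e2 mulrA -expr2 sqrr_sign mul1r.
rewrite (bigD1 A) ?subxx ?sA //= [RHS](bigD1 A) ?subxx ?sA //=.
rewrite [X in _ + X = _](eq_bigr (fun B => (-1) ^+ #|B| * 'X^(rank M - rk M B))).
  by move/addIr/(congr1 ( *%R ((-1) ^+ #|A|))); rewrite !mulrA -!expr2 !sqrr_sign !mul1r.
move=> B /andP[/andP[AB BE] ne]; rewrite /S IH //.
have : (#|A| < #|B|)%N by rewrite proper_card // properEneq eq_sym ne.
have := subset_leq_card BE; lia.
Qed.

Lemma chi_kernel M : ground M != set0 ->
  \sum_(F | flat M F) revp (rk M F) (chi (localization M F)) * chi (contraction M F) = 0.
Proof.
move=> ne.
transitivity (\sum_(F | flat M F) \sum_(A : {set T} | A \subset F)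
    (-1) ^+ #|A| * 'X^(rk M A) * chi (contraction M F)).
  apply: eq_bigr => F fF; rewrite -rank_localization revp_chi mulr_suml.
  by apply: eq_bigr => A AF; rewrite rk_localization.
rewrite (exchange_big_dep (fun A => A \subset ground M)) /=; last first.
  by move=> F A fF AF; apply: subset_trans AF (flat_sub fF).
transitivity (\sum_(A : {set T} | A \subset ground M) (-1) ^+ #|A| * 'X^(rank M) : {poly int}).
  apply: eq_bigr => A sA; rewrite -mulr_sumr sum_chi_contraction // -mulrA -exprD.
  by rewrite subnKC // rk_le_rank.
rewrite -mulr_suml; have := sum_sign (sub0set (ground M)).
rewrite eq_sym (negPf ne) => e.
rewrite (eq_bigl (fun B => (set0 \subset B) && (B \subset ground M))); last first.
  by move=> A; rewrite sub0set.
by rewrite e mul0r.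
Qed.

End CharPoly.

Section KLAxioms.
Context {T : finType}.
Implicit Types (M : matroid T) (F : {set T}) (P Q : matroid T -> {poly int}).

Definition KL_rank0 P M : bool :=
  (rank M == 0%N) ==> (P M == if ground M == set0 then 1 else 0).

(* deg P < rank / 2; [size] is degree + 1, and 0 for the zero polynomial, which
   satisfies the bound. *)
Definition KL_degree P M : bool :=
  (0 < rank M)%N ==> (2 * (size (P M)).-1 < rank M)%N.

Definition KL_equation P M : bool :=
  revp (rank M) (P M) ==
  \sum_(F | flat M F) chi (localization M F) * P (contraction M F).

Definition inverse_KL_equation Q M : bool :=
  (-1) ^+ rank M * revp (rank M) (Q M) ==
  \sum_(F | flat M F) (-1) ^+ rk M F * Q (localization M F)
                      * revp (rank M - rk M F) (chi (contraction M F)).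

Definition KL_assignment P : bool :=
  [forall M, [&& KL_rank0 P M, KL_degree P M & KL_equation P M]].

Definition inverse_KL_assignment Q : bool :=
  [forall M, [&& KL_rank0 Q M, KL_degree Q M & inverse_KL_equation Q M]].

End KLAxioms.

Section Halves.
Implicit Types (R P : {poly int}).

Definition halfp (r : nat) R : {poly int} := - \poly_(i < uphalf r) R`_i.

Lemma degree_halfp r R : (0 < r)%N -> (2 * (size (halfp r R)).-1 < r)%N.
Proof.
move=> r0; rewrite /halfp size_polyN; have := size_poly (uphalf r) (fun i => R`_i).
move: (size _) => n; rewrite uphalf_half; have := odd_double_half r; lia.
Qed.

Lemma revp_halfp r R : (size R <= r.+1)%N -> revp r R = - R ->
  revp r (halfp r R) - halfp r R = R.
Proof.
move=> sR eR; apply/polyP=> i; rewrite coefB coef_revp /halfp !coefN !coef_poly.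
have hR : (i <= r)%N -> R`_(r - i) = - R`_i.
  by move=> h; have := coef_revp r R i; rewrite h eR coefN.
have hi : (i < uphalf r)%N = (2 * i < r)%N by rewrite uphalf_half; have := odd_double_half r; lia.
have hj : (r - i < uphalf r)%N = (2 * (r - i) < r)%N by rewrite uphalf_half; have := odd_double_half r; lia.
rewrite hi hj opprK; case: (leqP i r) => h; last first.
  rewrite (@nth_default _ _ R i); last exact: leq_trans sR h.
  by rewrite add0r; case: ifP.
rewrite (hR h); case: ifP => h1; case: ifP => h2; rewrite ?opprK ?oppr0 ?addr0 ?add0r //; try lia.
have e : (r - i = i)%N by lia.
by have := hR h; rewrite e; lia.
Qed.

Lemma revp_eq0 r P : (0 < r)%N -> (2 * (size P).-1 < r)%N -> revp r P = P -> P = 0.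
Proof.
move=> r0 dP e; apply/polyP=> i; rewrite coef0.
have [h|h] := ltnP i (size P); last by rewrite nth_default.
rewrite -e coef_revp ifT; last by lia.
by rewrite nth_default //; move: h dP; move: (size P) => n; lia.
Qed.

Lemma size_degree r P : (0 < r)%N -> (2 * (size P).-1 < r)%N -> (size P <= r.+1)%N.
Proof. by move: (size P) => n; lia. Qed.

End Halves.

Section Existence.
Context {T : finType}.
Implicit Types (M : matroid T) (F G : {set T}) (P Q : matroid T -> {poly int}).

Lemma KL_size P M : KL_rank0 P M -> KL_degree P M -> (size (P M) <= (rank M).+1)%N.
Proof.
rewrite /KL_rank0 /KL_degree; case: (posnP (rank M)) => [-> /= /eqP -> _|r0 _ /=].
  by case: ifP; rewrite ?size_poly1 ?size_poly0.
exact: size_degree.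
Qed.

Lemma rk0 M : rk M set0 = 0%N.
Proof. by apply/eqP; rewrite -leqn0 -(cards0 T) rk_card. Qed.

Lemma flat0_loop M : ~~ flat M set0 -> exists2 x, x \in ground M & rk M [set x] = 0%N.
Proof.
rewrite /flat sub0set /= => /forallPn[x]; rewrite negb_imply setD0 -leqNgt setU0 rk0.
by case/andP=> xg; rewrite leqn0 => /eqP; exists x.
Qed.

Lemma flat_rk_rank0 M F : rank M = 0%N -> flat M F = (F == ground M).
Proof.
move=> r0; apply/idP/eqP=> [/flatP[s h]|->]; last exact: flat_ground.
apply/eqP; rewrite eqEsubset s /=; apply/subsetP=> x xg; apply: contraT => xF.
by have := h _ xg xF; have := rk_le_rank M (x |: F); lia.
Qed.

Lemma loop_sub_flat M F x : rk M [set x] = 0%N -> x \in ground M -> flat M F -> x \in F.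
Proof.
move=> rx xg /flatP[s h]; apply: contraT => xF.
by have := h _ xg xF; have := rk_submod M [set x] F; rewrite rx; lia.
Qed.

Lemma chi_localization_loop M F x : rk M [set x] = 0%N -> x \in ground M ->
  flat M F -> chi (localization M F) = 0.
Proof.
move=> rx xg fF; have xF := loop_sub_flat rx xg fF.
by apply: (chi_loop (x := x)) => //; rewrite rk_localization ?sub1set.
Qed.

Lemma sum_flat_contraction M F (f : {set T} -> {poly int}) : F \subset ground M ->
  \sum_(G | flat (contraction M F) G) f G =
  \sum_(G | flat M G && (F \subset G)) f (G :\: F).
Proof.
move=> sF; rewrite [RHS](reindex_onto (fun G => G :|: F) (fun G => G :\: F)) /=; last first.
  move=> B /andP[_ AB]; apply/setP=> z; rewrite !inE.
  by case: (boolP (z \in F)) => [/(subsetP AB) ->|_] //=; rewrite orbF.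
have e G : G \subset ground M :\: F -> (G :|: F) :\: F = G.
  rewrite subsetD => /andP[_ d]; rewrite setDUl setDv setU0; apply/setDidPl.
  exact: d.
apply: eq_big => [G|G fG]; last by rewrite e //; apply: (flat_sub fG).
rewrite subsetUr andbT; have [s|ns] := boolP (G \subset ground M :\: F).
  by rewrite flat_contraction // e // eqxx andbT.
rewrite /flat ground_contraction (negPf ns) /=; apply/esym/negP.
case/andP=> /andP[s _] /eqP eG; case/negP: ns; rewrite -eG.
by apply: setSD.
Qed.

Lemma sum_flat_localization M F (f : {set T} -> {poly int}) : flat M F ->
  \sum_(G | flat (localization M F) G) f G = \sum_(G | flat M G && (G \subset F)) f G.
Proof. by move=> fF; apply: eq_bigl => G; rewrite flat_localization. Qed.

Definition KL_tail P M : {poly int} :=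
  \sum_(F | flat M F && (F != set0)) chi (localization M F) * P (contraction M F).

Lemma card_contraction M F : F \subset ground M -> F != set0 ->
  (#|ground (contraction M F)| < #|ground M|)%N.
Proof.
move=> s ne; rewrite ground_contraction cardsD (setIidPr s).
by have := subset_leq_card s; move: ne; rewrite -card_gt0; lia.
Qed.

Lemma card_localization M F : F \subset ground M -> F != ground M ->
  (#|ground (localization M F)| < #|ground M|)%N.
Proof. by move=> s ne; apply: proper_card; rewrite properEneq ne. Qed.

Lemma rank_le_card M : (rank M <= #|ground M|)%N.
Proof. exact: rk_card. Qed.

Definition KL_at P M := [&& KL_rank0 P M, KL_degree P M & KL_equation P M].

Lemma size_KL_tail P M :
  (forall N, (#|ground N| < #|ground M|)%N -> KL_at P N) ->
  (size (KL_tail P M) <= (rank M).+1)%N.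
Proof.
move=> IH; apply: leq_trans (size_sum _ _ _) _; apply/bigmax_leqP=> F /andP[fF nF].
have /and3P[a b _] := IH _ (card_contraction (flat_sub fF) nF).
have := KL_size a b; have := size_chi (localization M F).
rewrite rank_contraction rank_localization => h1 h2.
apply: leq_trans (size_polyMleq _ _) _; have := rk_le_rank M F; lia.
Qed.

Lemma revp_KL_tail P M :
  (forall N, (#|ground N| < #|ground M|)%N -> KL_at P N) ->
  flat M set0 -> revp (rank M) (KL_tail P M) = - KL_tail P M.
Proof.
move=> IH f0; rewrite /KL_tail linear_sum /=.
transitivity (\sum_(F | flat M F && (F != set0)) \sum_(G | flat M G && (F \subset G))
   revp (rk M F) (chi (localization M F)) * chi (contraction (localization M G) F)
     * P (contraction M G)).
  apply: eq_bigr => F /andP[fF nF]; have sF := flat_sub fF.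
  have /and3P[a b /eqP c] := IH _ (card_contraction sF nF).
  have -> : rank M = (rk M F + rank (contraction M F))%N.
    by rewrite rank_contraction subnKC // rk_le_rank.
  rewrite revpM ?c ?KL_size //; last by rewrite -rank_localization size_chi.
  rewrite (@sum_flat_contraction M F _ sF) mulr_sumr; apply: eq_bigr => G /andP[fG FG].
  by rewrite localization_contraction ?contractionK ?flat_sub // mulrA.
rewrite (exchange_big_dep (fun G => flat M G && (G != set0))) /=; last first.
  move=> F G /andP[_ nF] /andP[-> FG] /=; apply: contra nF => /eqP e.
  by rewrite -subset0 -e.
rewrite -sumrN; apply: eq_bigr => G /andP[fG nG]; rewrite -mulr_suml -mulNr.
congr (_ * _); have := @chi_kernel _ (localization M G) nG.
rewrite sum_flat_localization // (bigD1 set0) ?f0 ?sub0set //= => /eqP.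
rewrite addrC addr_eq0 contraction0 localizationK ?sub0set // chi_empty //.
rewrite rk0 (_ : revp 0 1 = 1) ?mul1r; last first.
  by rewrite -(expr0 'X) revpXn // subnn.
move=> /eqP <-; apply: eq_big => [F|F]; first by rewrite fG /= andbAC.
move=> /andP[/andP[fF nF] /andP[_ FG]].
by rewrite localizationK // rk_localization.
Qed.

Lemma KL_tail_loop P M : ~~ flat M set0 -> KL_tail P M = 0.
Proof.
move=> /flat0_loop[x xg rx]; rewrite /KL_tail big1 // => F /andP[fF _].
by rewrite (chi_localization_loop rx xg fF) mul0r.
Qed.

Lemma KL_sumE P M : \sum_(F | flat M F) chi (localization M F) * P (contraction M F)
  = (if flat M set0 then P M else 0) + KL_tail P M.
Proof.
case: ifP => f0.
  by rewrite (bigD1 set0) //= contraction0 chi_empty // mul1r.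
rewrite add0r; apply: eq_bigl => F; case: eqP => [->|]; rewrite ?f0 //= andbT //.
Qed.

Lemma KL_atP P M :
  (forall N, (#|ground N| < #|ground M|)%N -> KL_at P N) ->
  P M = (if rank M == 0%N then (if ground M == set0 then 1 else 0)
         else halfp (rank M) (KL_tail P M)) -> KL_at P M.
Proof.
move=> IH eP; rewrite /KL_at /KL_rank0 /KL_degree /KL_equation KL_sumE.
case: (posnP (rank M)) => [r0|rp]; last first.
  rewrite gtn_eqF //= in eP *; rewrite eP degree_halfp //=.
  have [f0|f0] := boolP (flat M set0).
    rewrite -{3}(revp_halfp (size_KL_tail IH) (revp_KL_tail IH f0)).
    by rewrite addrC subrK.
  rewrite KL_tail_loop // addr0 /halfp.
  by rewrite (_ : \poly_(i < _) _ = 0) ?oppr0 ?linear0 //; apply/polyP=> i; rewrite coef_poly !coef0 if_same.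
rewrite r0 eqxx /= in eP *; rewrite eP eqxx /=.
have r1 : revp 0 1 = 1 by rewrite -(expr0 'X) revpXn // subnn.
rewrite /KL_tail; have [e|ne] := eqVneq (ground M) set0.
  have -> : flat M set0 by rewrite flat_rk_rank0 // e.
  by rewrite r1 big1 ?addr0 // => F; rewrite flat_rk_rank0 // e andbN.
rewrite linear0 if_same add0r eq_sym big1 // => F /andP[fF _].
have [x xg] := set0Pn _ ne.
rewrite (@chi_localization_loop M F x) ?mul0r //.
by have := rk_le_rank M [set x]; lia.
Qed.

Lemma KL_at_eq P P' M :
  (forall N, (#|ground N| <= #|ground M|)%N -> P N = P' N) -> KL_at P M = KL_at P' M.
Proof.
move=> e; rewrite /KL_at /KL_rank0 /KL_degree /KL_equation e //; congr [&& _, _ & _ == _].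
apply: eq_bigr => F fF; rewrite e // ground_contraction.
by rewrite subset_leq_card // subsetDl.
Qed.

Lemma KL_exists_fun : exists P, forall M, KL_at P M.
Proof.
suff [P h] : exists P, forall M, (#|ground M| < #|T|.+1)%N -> KL_at P M.
  by exists P => M; apply: h; rewrite ltnS max_card.
elim: #|T|.+1 => [|n [P IH]]; first by exists (fun=> 0).
pose P' M := if (#|ground M| < n)%N then P M
  else if rank M == 0%N then (if ground M == set0 then 1 else 0)
         else halfp (rank M) (KL_tail P M).
have lt M : (#|ground M| < n)%N -> KL_at P' M.
  move=> h; rewrite -(@KL_at_eq P) ?IH // => N l; rewrite /P' ifT //.
  exact: leq_ltn_trans h.
exists P' => M; rewrite ltnS leq_eqVlt => /orP[/eqP eM|]; last exact: lt.
apply: KL_atP => [N|]; rewrite ?eM; first exact: lt.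
rewrite {1}/P' eM ltnn; case: ifP => // _; congr halfp.
apply: eq_bigr => F /andP[fF nF]; rewrite /P' ifT //.
by rewrite -eM card_contraction // flat_sub.
Qed.

Lemma KL_unique_fun P P' : (forall M, KL_at P M) -> (forall M, KL_at P' M) -> P =1 P'.
Proof.
move=> hP hP' M; have [n] := ubnP #|ground M|; elim: n M => // n IH M ltn.
have /and3P[a b c] := hP M; have /and3P[a' b' c'] := hP' M.
case: (posnP (rank M)) => [r0|rp].
  by move: a a'; rewrite /KL_rank0 r0 /= => /eqP -> /eqP ->.
have sP := KL_size a b; have sP' := KL_size a' b'.
move: b b' c c'; rewrite /KL_degree /KL_equation !KL_sumE rp /= => b b' /eqP c /eqP c'.
have et : KL_tail P M = KL_tail P' M.
  apply: eq_bigr => F /andP[fF nF]; rewrite IH //.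
  by have := card_contraction (flat_sub fF) nF; lia.
apply/eqP; rewrite -subr_eq0; apply/eqP; case: (boolP (flat M set0)) c c' => f0 c c'.
  apply: (revp_eq0 rp).
    apply: leq_ltn_trans (_ : 2 * (maxn (size (P M)) (size (P' M))).-1 < _)%N.
      rewrite leq_mul2l /=; have := size_polyD (P M) (- P' M).
      by rewrite size_polyN => hs; rewrite -!subn1 leq_sub2r.
    by move: b b'; move: (size (P M)) (size (P' M)) => s s'; lia.
  by rewrite linearB /= c c' et opprD addrACA subrr addr0.
by rewrite -(revpK sP) -(revpK sP') c c' et subrr.
Qed.

Definition iKL_at Q M := [&& KL_rank0 Q M, KL_degree Q M & inverse_KL_equation Q M].

Definition iKL_tail Q M : {poly int} :=
  \sum_(F | flat M F && (F != ground M)) (-1) ^+ rk M F * Q (localization M F)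
     * revp (rank M - rk M F) (chi (contraction M F)).

Lemma iKL_sumE Q M : \sum_(F | flat M F) (-1) ^+ rk M F * Q (localization M F)
     * revp (rank M - rk M F) (chi (contraction M F))
  = (-1) ^+ rank M * Q M + iKL_tail Q M.
Proof.
rewrite (bigD1 (ground M)) ?flat_ground //= localizationT -/(rank M) subnn.
rewrite chi_empty; last by rewrite ground_contraction setDv.
by rewrite (_ : revp 0 1 = 1) ?mulr1 // -(expr0 'X) revpXn // subnn.
Qed.

Lemma size_sign_mul (a : nat) (p : {poly int}) : size ((-1) ^+ a * p) = size p.
Proof. by rewrite -signr_odd mulr_sign; case: odd; rewrite ?size_polyN. Qed.

Lemma revp_sign_mul (a n : nat) (p : {poly int}) : revp n ((-1) ^+ a * p) = (-1) ^+ a * revp n p.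
Proof. by rewrite -signr_odd !mulr_sign; case: odd; rewrite ?linearN. Qed.

Lemma size_iKL_tail Q M :
  (forall N, (#|ground N| < #|ground M|)%N -> iKL_at Q N) ->
  (size (iKL_tail Q M) <= (rank M).+1)%N.
Proof.
move=> IH; apply: leq_trans (size_sum _ _ _) _; apply/bigmax_leqP=> F /andP[fF nF].
have /and3P[a b _] := IH _ (card_localization (flat_sub fF) nF).
have := KL_size a b; have := size_revp (rank M - rk M F) (chi (contraction M F)).
rewrite rank_localization -mulrA size_sign_mul => h1 h2.
apply: leq_trans (size_polyMleq _ _) _; have := rk_le_rank M F; lia.
Qed.

Lemma revp_iKL_tail Q M :
  (forall N, (#|ground N| < #|ground M|)%N -> iKL_at Q N) ->
  revp (rank M) (iKL_tail Q M) = - iKL_tail Q M.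
Proof.
move=> IH; rewrite /iKL_tail linear_sum /=.
transitivity (\sum_(F | flat M F && (F != ground M)) \sum_(G | flat M G && (G \subset F))
   ((-1) ^+ rk M G * Q (localization M G)) *
   (revp (rk M F - rk M G) (chi (localization (contraction M G) (F :\: G)))
     * chi (contraction (contraction M G) (F :\: G)))).
  apply: eq_bigr => F /andP[fF nF]; have sF := flat_sub fF.
  have /and3P[a b /eqP c] := IH _ (card_localization sF nF).
  have eM : rank M = (rk M F + (rank M - rk M F))%N by rewrite subnKC // rk_le_rank.
  rewrite {1}eM -mulrA revp_sign_mul revpM; first last.
  - exact: size_revp.
  - by rewrite -rank_localization KL_size.
  rewrite revpK; last by rewrite -rank_contraction size_chi.
  rewrite mulrA; rewrite rank_localization in c; rewrite c.
  rewrite sum_flat_localization // mulr_suml; apply: eq_bigr => G /andP[fG GF].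
  rewrite localizationK // rk_localization // -localization_contraction //.
  by rewrite contractionK // mulrA.
rewrite (exchange_big_dep (fun G => flat M G && (G != ground M))) /=; last first.
  move=> F G /andP[fF nF] /andP[-> GF] /=; apply: contra nF => /eqP e.
  by rewrite eqEsubset (flat_sub fF) -e.
rewrite -sumrN; apply: eq_bigr => G /andP[fG nG]; rewrite -mulr_sumr -mulrN.
congr (_ * _); have sG := flat_sub fG.
have nC : ground (contraction M G) != set0.
  by rewrite ground_contraction setD_eq0; apply: contra nG => s; rewrite eqEsubset sG.
have := chi_kernel nC.
rewrite sum_flat_contraction // (bigD1 (ground M)) ?flat_ground //= => /eqP.
rewrite addrC addr_eq0 -/(ground (contraction M G)) localizationT -/(rank _) rank_contraction.
rewrite (@chi_empty _ (contraction (contraction M G) _)); last first.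
  by rewrite !ground_contraction setDv.
rewrite mulr1 => /eqP <-; apply: eq_big => [F|F].
  by rewrite fG /= andbAC.
move=> /andP[/andP[fF nF] /andP[_ GF]]; congr (revp _ _ * _).
rewrite rk_contraction ?setSD ?flat_sub //; congr (rk M _ - _)%N.
by apply/setP=> z; rewrite !inE; case: (boolP (z \in G)) => [/(subsetP GF) ->|_] //=; rewrite orbF.
Qed.

Lemma iKL_atP Q M :
  (forall N, (#|ground N| < #|ground M|)%N -> iKL_at Q N) ->
  Q M = (if rank M == 0%N then (if ground M == set0 then 1 else 0)
         else halfp (rank M) ((-1) ^+ rank M * iKL_tail Q M)) -> iKL_at Q M.
Proof.
move=> IH eQ; rewrite /iKL_at /KL_rank0 /KL_degree /inverse_KL_equation iKL_sumE.
case: (posnP (rank M)) => [r0|rp]; last first.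
  rewrite gtn_eqF //= in eQ *; rewrite eQ degree_halfp //=.
  set R := (-1) ^+ rank M * iKL_tail Q M.
  have sR : (size R <= (rank M).+1)%N by rewrite size_sign_mul size_iKL_tail.
  have eR : revp (rank M) R = - R by rewrite revp_sign_mul revp_iKL_tail // mulrN.
  have -> : iKL_tail Q M = (-1) ^+ rank M * R by rewrite mulrA -expr2 sqrr_sign mul1r.
  by rewrite -mulrDr -{3}(revp_halfp sR eR) addrC subrK.
rewrite r0 eqxx /= in eQ *; rewrite eQ eqxx /= !expr0 !mul1r.
rewrite /iKL_tail big1 ?addr0; last by move=> F; rewrite flat_rk_rank0 // andbN.
by case: ifP => _; rewrite ?linear0 // -(expr0 'X) revpXn // subnn.
Qed.

Lemma iKL_at_eq Q Q' M :
  (forall N, (#|ground N| <= #|ground M|)%N -> Q N = Q' N) -> iKL_at Q M = iKL_at Q' M.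
Proof.
move=> e; rewrite /iKL_at /KL_rank0 /KL_degree /inverse_KL_equation e //.
congr [&& _, _ & _ == _].
apply: eq_bigr => F fF; rewrite e // ground_localization.
by rewrite subset_leq_card // flat_sub.
Qed.

Lemma iKL_exists_fun : exists Q, forall M, iKL_at Q M.
Proof.
suff [Q h] : exists Q, forall M, (#|ground M| < #|T|.+1)%N -> iKL_at Q M.
  by exists Q => M; apply: h; rewrite ltnS max_card.
elim: #|T|.+1 => [|n [Q IH]]; first by exists (fun=> 0).
pose Q' M := if (#|ground M| < n)%N then Q M
  else if rank M == 0%N then (if ground M == set0 then 1 else 0)
         else halfp (rank M) ((-1) ^+ rank M * iKL_tail Q M).
have lt M : (#|ground M| < n)%N -> iKL_at Q' M.
  move=> h; rewrite -(@iKL_at_eq Q) ?IH // => N l; rewrite /Q' ifT //.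
  exact: leq_ltn_trans h.
exists Q' => M; rewrite ltnS leq_eqVlt => /orP[/eqP eM|]; last exact: lt.
apply: iKL_atP => [N|]; rewrite ?eM; first exact: lt.
rewrite {1}/Q' eM ltnn; case: ifP => // _; congr halfp; congr (_ * _).
apply: eq_bigr => F /andP[fF nF]; rewrite /Q' ifT //.
by rewrite -eM card_localization // flat_sub.
Qed.

Lemma iKL_unique_fun Q Q' : (forall M, iKL_at Q M) -> (forall M, iKL_at Q' M) -> Q =1 Q'.
Proof.
move=> hQ hQ' M; have [n] := ubnP #|ground M|; elim: n M => // n IH M ltn.
have /and3P[a b c] := hQ M; have /and3P[a' b' c'] := hQ' M.
case: (posnP (rank M)) => [r0|rp].
  by move: a a'; rewrite /KL_rank0 r0 /= => /eqP -> /eqP ->.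
move: b b' c c'; rewrite /KL_degree /inverse_KL_equation !iKL_sumE rp /= => b b' /eqP c /eqP c'.
have et : iKL_tail Q M = iKL_tail Q' M.
  apply: eq_bigr => F /andP[fF nF]; rewrite IH //.
  by have := card_localization (flat_sub fF) nF; lia.
apply/eqP; rewrite -subr_eq0; apply/eqP; apply: (revp_eq0 rp).
  apply: leq_ltn_trans (_ : 2 * (maxn (size (Q M)) (size (Q' M))).-1 < _)%N.
    rewrite leq_mul2l /=; have := size_polyD (Q M) (- Q' M).
    by rewrite size_polyN => hs; rewrite -!subn1 leq_sub2r.
  by move: b b'; move: (size (Q M)) (size (Q' M)) => s s'; lia.
have : (-1) ^+ rank M * revp (rank M) (Q M - Q' M) = (-1) ^+ rank M * (Q M - Q' M).
  by rewrite linearB /= mulrBr c c' et opprD addrACA subrr addr0 mulrBr.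
by move/(congr1 ( *%R ((-1) ^+ rank M))); rewrite !mulrA -!expr2 !sqrr_sign !mul1r.
Qed.

End Existence.

Section KLPolynomials.
Variable T : finType.

Fact KL_exists : exists P : {ffun matroid T -> {poly int}}, KL_assignment P.
Proof.
have [P hP] := @KL_exists_fun T; exists [ffun M => P M]; apply/forallP=> M.
by have := hP M; rewrite (@KL_at_eq _ P [ffun M => P M]) // => N _; rewrite ffunE.
Qed.

Fact inverse_KL_exists :
  exists Q : {ffun matroid T -> {poly int}}, inverse_KL_assignment Q.
Proof.
have [Q hQ] := @iKL_exists_fun T; exists [ffun M => Q M]; apply/forallP=> M.
by have := hQ M; rewrite (@iKL_at_eq _ Q [ffun M => Q M]) // => N _; rewrite ffunE.
Qed.

Lemma KL_unique (P P' : matroid T -> {poly int}) :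
  KL_assignment P -> KL_assignment P' -> P =1 P'.
Proof. by move=> /forallP h /forallP h'; apply: KL_unique_fun. Qed.

Lemma inverse_KL_unique (Q Q' : matroid T -> {poly int}) :
  inverse_KL_assignment Q -> inverse_KL_assignment Q' -> Q =1 Q'.
Proof. by move=> /forallP h /forallP h'; apply: iKL_unique_fun. Qed.

End KLPolynomials.

(* All matroids on subsets of T are handled at once: this class is closed under
   localization and contraction, so the conditions determine the assignment on
   it ([KL_unique], [inverse_KL_unique]). *)
Definition KL (T : finType) (M : matroid T) : {poly int} :=
  xchoose (KL_exists T) M.

Definition inverse_KL (T : finType) (M : matroid T) : {poly int} :=
  xchoose (inverse_KL_exists T) M.

Lemma KLP (T : finType) : KL_assignment (@KL T).
Proof. exact: (xchooseP (KL_exists T)). Qed.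

Lemma inverse_KLP (T : finType) : inverse_KL_assignment (@inverse_KL T).
Proof. exact: (xchooseP (inverse_KL_exists T)). Qed.

Definition Zpoly (T : finType) (M : matroid T) : {poly int} :=
  \sum_(F | flat M F) 'X^(rk M F) * KL (contraction M F).

(* Main.v *)
(* Let N be the relaxation of M at H, k the rank and h = |H|. Stressedness says that the rank
   of A <= H is min(|A|, k - 1) in M and min(|A|, k) in N, while the two ranks agree off H.
   So the flats of N are those of M other than H together with the (k - 1)-subsets of H. A
   flat F not inside H and different from E has the same localization and contraction in
   both; a flat F inside H with |F| < k - 1 has a Boolean localization, and N/F is the
   relaxation of M/F at H - F. Subtracting the defining recursions for M and N thus leaves
   only terms depending on k and h (for P by induction on k), and the degree bound extracts
   P_N - P_M and Q_N - Q_M from p(t) |-> t^k p(1/t) - p(t). *)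
Require Import Defs.
From mathcomp Require Import all_boot all_order all_algebra.
From mathcomp Require Import zify ring.

Set Implicit Arguments.
Unset Strict Implicit.
Unset Printing Implicit Defensive.

Import GRing.Theory.

(** * Subsets of prescribed size *)

Section FiniteSets.
Context {T : finType}.
Implicit Types (A B S : {set T}).

Lemma exists_card_between A B n : A \subset B -> #|A| <= n <= #|B| ->
  exists S, [/\ A \subset S, S \subset B & #|S| = n].
Proof.
move=> sAB /andP[lA lB].
have : 0 < 'C(#|B :\: A|, n - #|A|).
  by rewrite bin_gt0 cardsD (setIidPr sAB) leq_sub2r.
rewrite -cards_draws => /card_gt0P[S]; rewrite inE subsetD => /andP[/andP[SB d] /eqP c].
exists (A :|: S); split; rewrite ?subsetUl ?subUset ?sAB //.
have /eqP -> : #|A :|: S| == #|A| + #|S|.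
  by case: (leq_card_setU A S) => _ ->; rewrite disjoint_sym.
by rewrite c subnKC.
Qed.

(** Groups the subsets of [A] by size. This is how sums over subsets of [H] become expressions in k
    and h alone. *)
Lemma sum_by_card (R : nmodType) A (P : pred nat) (g : nat -> R) :
  (\sum_(S : {set T} | (S \subset A) && P #|S|) g #|S| =
   \sum_(i < #|A|.+1 | P i) g i *+ 'C(#|A|, i))%R.
Proof.
rewrite (partition_big (fun S : {set T} => inord #|S| : 'I_#|A|.+1) (fun i => P i)) /=; last first.
  by move=> S /andP[s p]; rewrite inordK // ltnS subset_leq_card.
apply: eq_bigr => i Pi; rewrite -cards_draws -sumr_const; apply: eq_big => [S|S].
  rewrite inE; case: (boolP (S \subset A)) => //= s.
  rewrite -val_eqE /= inordK ?ltnS ?subset_leq_card //.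
  by case: eqP => [->|]; rewrite ?Pi ?andbF.
by case/andP=> /andP[s _] /eqP <-; rewrite inordK // ltnS subset_leq_card.
Qed.

End FiniteSets.

(** * Ranks, flats and minors of a matroid and of its relaxation at a stressed hyperplane *)

Section StressedHyperplanes.
Context {T : finType}.
Implicit Types (M N : matroid T) (A B F G H S : {set T}).

Lemma flat_full_rank M F : flat M F -> rk M F = rank M -> F = ground M.
Proof.
move=> /flatP[s h] r; apply/eqP; rewrite eqEsubset s; apply/subsetP=> x xg.
by apply: contraT => xF; have := h x xg xF; have := rk_le_rank M (x |: F); lia.
Qed.

(** Rank form of stressedness: M restricted to [H] is uniform of rank k - 1. A subset of [H] with
    fewer than k elements extends to a k-subset of [H], which is a circuit, so it is independent.
    Every later rank computation inside [H] goes through this form. *)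
Lemma stressed_hyperplaneP M H :
  reflect [/\ flat M H, (rk M H).+1 = rank M &
            forall A, A \subset H -> rk M A = minn #|A| (rk M H)]
          (stressed_hyperplane M H).
Proof.
apply: (iffP idP) => [/andP[/andP[fH /eqP rH] /forallP st]|[fH rH u]].
  split=> // A AH.
  have small B : B \subset H -> #|B| <= rk M H -> rk M B = #|B|.
    move=> BH lB; suff : indep M B by rewrite indepE => /eqP.
    (* If |H| = k - 1 there is no k-subset to extend to, but then [H] itself is independent. *)
    have [lt|ge] := ltnP (rk M H) #|H|; last first.
      apply: indep_sub BH; rewrite indepE eqn_leq ge; exact: rk_card.
    have [|S [BS SH cS]] := @exists_card_between _ B H (rank M) BH; first lia.
    have := st S; rewrite SH cS eqxx => /and3P[_ _ /forallP /(_ B) /implyP]; apply.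
    by rewrite properEcard BS cS /= -rH ltnS.
  have [l|g] := leqP #|A| (rk M H); first by rewrite small.
  have [|S [_ SA cS]] := @exists_card_between _ set0 A (rk M H) (sub0set _).
    by rewrite cards0 (ltnW g).
  have := rkS M SA; rewrite small ?cS //; last exact: subset_trans SA AH.
  by have := rkS M AH; lia.
apply/andP; split; first by rewrite /hyperplane fH rH /=.
apply/forallP=> S; apply/implyP=> /andP[SH /eqP cS]; apply/and3P; split.
- exact: subset_trans SH (flat_sub fH).
- by rewrite indepE u // cS; lia.
apply/forallP=> I; apply/implyP=> pI; rewrite indepE u ?(subset_trans (proper_sub pI)) //.
by have := proper_card pI; lia.
Qed.

Section Fixed.
Variables (M : matroid T) (H : {set T}) (sH : stressed_hyperplane M H).
Let N := relaxation sH.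

Lemma stressed_flat : flat M H. Proof. by case/stressed_hyperplaneP: sH. Qed.
Lemma stressed_sub : H \subset ground M. Proof. exact: flat_sub stressed_flat. Qed.
Lemma stressed_rkH : (rk M H).+1 = rank M. Proof. by case/stressed_hyperplaneP: sH. Qed.

Lemma stressed_rk A : A \subset H -> rk M A = minn #|A| (rank M).-1.
Proof. by rewrite -stressed_rkH; case/stressed_hyperplaneP: sH => _ _; apply. Qed.

Lemma stressed_card : rank M <= #|H|.+1.
Proof. by rewrite -stressed_rkH ltnS rk_card. Qed.

(** Submodularity applied to [H] and [x |: A], which meet in [A]: a point that raises the rank of
    [H] raises the rank of each of its subsets. *)
Lemma rk_add_stressed A x : A \subset H -> x \in ground M -> x \notin H ->
  rk M (x |: A) = (rk M A).+1.
Proof.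
move=> AH xg xH; have /flatP[_ /(_ x xg xH)] := stressed_flat.
have := rk_submod M H (x |: A); have := rk_submod M [set x] A.
have := rk_card M [set x]; rewrite cards1.
have -> : H :|: (x |: A) = x |: H by rewrite setUCA (setUidPl AH).
have -> : H :&: (x |: A) = A.
  apply/setP=> z; rewrite !inE; case: eqP => [->|_] /=.
    by rewrite (negPf xH); apply/esym/negP=> /(subsetP AH); apply/negP.
  by apply: andb_idl; apply: (subsetP AH).
by lia.
Qed.

(** A point of [A] outside [H] adds one to the rank of [A :&: H]. *)
Lemma rk_cross_stressed A : A \subset ground M -> ~~ (A \subset H) ->
  rk M A >= (minn #|A :&: H| (rank M).-1).+1.
Proof.
move=> Ag /subsetPn[x xA xH]; rewrite -stressed_rk ?subsetIr //.
rewrite -(rk_add_stressed (subsetIr _ _) (subsetP Ag _ xA) xH) rkS //.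
by rewrite subUset sub1set xA subsetIl.
Qed.

(** A new base is a k-subset of [H], so it meets [A] in at most min(|A ∩ H|, k) elements. When [A]
    leaves [H], [rk_cross_stressed] shows that its old rank is already that large, so only ranks
    inside [H] can grow. *)
Lemma rk_relaxation A : A \subset ground M ->
  rk N A = if A \subset H then minn #|A| (rank M) else rk M A.
Proof.
move=> Ag.
have bN B : B \in bases N = (B \in bases M) || (B \subset H) && (#|B| == rank M).
  by rewrite !inE.
have cN B : B \in bases N -> #|B| = rank M.
  by rewrite bN basesE => /orP[/and3P[_ _ /eqP]|/andP[_ /eqP]].
have ge : rk M A <= rk N A.
  by apply/bigmax_leqP=> B hB; apply: rk_ge; rewrite bN hB.
apply/eqP; rewrite eqn_leq; case: ifP => AH; apply/andP; split.
- rewrite leq_min rk_card; apply/bigmax_leqP=> B /cN <-.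
  exact: subset_leq_card (subsetIl _ _).
- have [l|g] := ltnP #|A| (rank M).
    by move: ge; rewrite stressed_rk //; lia.
  have [|S [_ SA cS]] := @exists_card_between _ set0 A (rank M) (sub0set _).
    by rewrite cards0.
  have hS : S \in bases N by rewrite bN cS eqxx (subset_trans SA AH) orbT.
  by have := rk_ge A hS; rewrite (setIidPl SA) cS; lia.
- apply/bigmax_leqP=> B; rewrite bN => /orP[/rk_ge //|/andP[BH /eqP cB]].
  apply: leq_trans (rk_cross_stressed Ag (negbT AH)).
  have := subset_leq_card (subsetIl B A); have : #|B :&: A| <= #|A :&: H|.
    by apply: subset_leq_card; rewrite subsetI subsetIr (subset_trans (subsetIl _ _) BH).
  lia.
exact: ge.
Qed.

Lemma ground_nsub_stressed : ~~ (ground M \subset H).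
Proof.
by apply/negP=> /(@rkS _ M); have := stressed_rkH; rewrite -/(rank M); lia.
Qed.

Lemma ground_relaxation : ground N = ground M. Proof. by []. Qed.

Lemma rank_relaxation : rank N = rank M.
Proof. by rewrite /rank rk_relaxation // (negPf ground_nsub_stressed). Qed.

Lemma flat_stressed F : F \subset H -> flat M F = (F == H) || (#|F| < (rank M).-1).
Proof.
move=> FH; have Fg := subset_trans FH stressed_sub.
have rF := stressed_rk FH; have rH := stressed_rkH.
apply/idP/orP=> [/flatP[_ h]|[/eqP ->|lt]]; last 2 first.
- exact: stressed_flat.
- apply/flatP; split=> // x xg xF; have [xH|xH] := boolP (x \in H).
    rewrite [in X in _ < X]stressed_rk ?subUset ?sub1set ?xH // cardsU1 xF; lia.
  by rewrite rk_add_stressed.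
have [|ge] := ltnP #|F| (rank M).-1; [by right|left].
rewrite eqEsubset FH; apply/subsetP=> x xH; apply: contraT => xF.
have := h x (subsetP stressed_sub _ xH) xF.
rewrite [in X in _ < X]stressed_rk ?subUset ?sub1set ?xH //; lia.
Qed.

Lemma flat_relaxation_sub F : F \subset H -> flat N F = (#|F| < rank M).
Proof.
move=> FH; have Fg := subset_trans FH stressed_sub.
have rF := rk_relaxation Fg; rewrite FH in rF; have rH := stressed_rkH.
apply/idP/idP=> [fF|lt].
  rewrite ltnNge; apply: contra ground_nsub_stressed => le.
  by rewrite -ground_relaxation -(flat_full_rank fF) // rF rank_relaxation; lia.
apply/flatP; split=> // x xg xF.
rewrite [in X in _ < X]rk_relaxation ?subUset ?sub1set ?xg // FH andbT.
case: ifP => xH; first by rewrite cardsU1 xF; lia.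
by rewrite rk_add_stressed ?xH // stressed_rk //; lia.
Qed.

Lemma flat_relaxation_nsub F : ~~ (F \subset H) -> flat N F = flat M F.
Proof.
move=> FH.
have r A : F \subset A -> A \subset ground M -> rk N A = rk M A.
  move=> FA Ag; rewrite rk_relaxation // ifF //.
  by apply: contraNF FH; apply: subset_trans.
by apply/flatP/flatP=> -[s h]; split=> // x xg xF; have := h x xg xF;
  rewrite !r // ?subsetUr ?subUset ?sub1set ?xg.
Qed.

Lemma contraction_relaxation_nsub F : F \subset ground M -> ~~ (F \subset H) ->
  contraction N F = contraction M F.
Proof.
move=> Fg FH; have r A : A \subset ground M -> rk N (A :|: F) = rk M (A :|: F).
  by move=> Ag; rewrite rk_relaxation ?subUset ?Ag // (negPf FH) andbF.
apply: eq_matroid_rk => // A sA; rewrite !rk_contraction // r; last first.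
  exact: subset_trans sA (subsetDl _ _).
by have := r set0; rewrite !set0U sub0set => ->.
Qed.

(** A flat other than the ground set has rank at most k - 1, so [rk_cross_stressed] forces |F ∩ H|
    <= k - 2. On sets that small, both min(|A|, k - 1) and min(|A|, k) equal |A|. *)
Lemma localization_relaxation_nsub F : flat M F -> ~~ (F \subset H) ->
  F != ground M -> localization N F = localization M F.
Proof.
move=> fF FH ne; have Fg := flat_sub fF; apply: eq_matroid_rk => // A AF.
rewrite !rk_localization // rk_relaxation ?(subset_trans AF Fg) //; case: ifP => // AH.
rewrite stressed_rk //; have := rk_cross_stressed Fg FH.
have : #|A| <= #|F :&: H| by rewrite subset_leq_card // subsetI AF.
have : rk M F <> rank M by move/(flat_full_rank fF)/eqP; apply/negP.
have := rk_le_rank M F; lia.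
Qed.

(** The caps k - 1 and k agree on sets of at most k - 1 elements. *)
Lemma localization_relaxation_sub F : F \subset H -> #|F| < rank M ->
  localization N F = localization M F.
Proof.
move=> FH lt; apply: eq_matroid_rk => // A AF; have AH := subset_trans AF FH.
rewrite !rk_localization // rk_relaxation ?(subset_trans AH stressed_sub) // AH.
by rewrite stressed_rk //; have := subset_leq_card AF; rewrite ground_localization; lia.
Qed.

Lemma stressed_indep F : F \subset H -> #|F| < rank M -> indep M F.
Proof. by move=> FH lt; rewrite indepE stressed_rk //; lia. Qed.

(** Since [F] is independent, contracting it lowers both the sizes and the cap k - 1 by |F|, so the
    rank form of stressedness persists. *)
Lemma stressed_contraction F : F \subset H -> #|F| < (rank M).-1 ->
  stressed_hyperplane (contraction M F) (H :\: F).
Proof.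
move=> FH lt; have Hg := stressed_sub; have Fg := subset_trans FH Hg.
have rH := stressed_rkH; have DF : H :\: F :|: F = H.
  by rewrite setUC -{2}(setID H F) (setIidPr FH).
have rF : rk M F = #|F| by rewrite stressed_rk //; lia.
have rD : rk (contraction M F) (H :\: F) = rk M H - #|F|.
  by rewrite rk_contraction ?setSD // DF rF.
apply/stressed_hyperplaneP; rewrite rD; split.
- by rewrite flat_contraction ?setSD // DF stressed_flat.
- by rewrite rank_contraction rF; lia.
move=> A AD; rewrite rk_contraction ?(subset_trans AD) ?setSD // rF.
move: AD; rewrite subsetD => /andP[AH d]; rewrite stressed_rk ?subUset ?AH //.
have /eqP -> : #|A :|: F| == #|A| + #|F| by case: (leq_card_setU A F) => _ ->.
lia.
Qed.

End Fixed.

(** Relaxation commutes with contraction of a small subset of [H]; this makes induction on the rank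
    possible. *)
Lemma contraction_relaxation_sub M H (sH : stressed_hyperplane M H) F
    (FH : F \subset H) (lt : #|F| < (rank M).-1) :
  contraction (relaxation sH) F = relaxation (stressed_contraction sH FH lt).
Proof.
have Fg := subset_trans FH (stressed_sub sH).
have rF : rk M F = #|F| by rewrite (stressed_rk sH) //; lia.
have rNF : rk (relaxation sH) F = #|F| by rewrite rk_relaxation // FH; lia.
apply: eq_matroid_rk => // A sA; rewrite rk_contraction // rNF.
have := sA; rewrite subsetD => /andP[Ag d].
have /eqP cAF : #|A :|: F| == #|A| + #|F| by case: (leq_card_setU A F) => _ ->.
rewrite !rk_relaxation // ?subUset ?Ag ?Fg // FH andbT subsetD d andbT cAF.
rewrite rank_contraction rF rk_contraction // rF.
case: ifP => // _; lia.
Qed.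

End StressedHyperplanes.

(** * Recovering a polynomial of low degree from its antisymmetrization *)

Section Polynomials.
Local Open Scope ring_scope.

Lemma revp01 : revp 0 1 = 1.
Proof. by rewrite -(expr0 'X) revpXn // subnn. Qed.

(** As deg p < r/2, the polynomial t^r p(1/t) has no terms of degree below r/2. The lower half of
    the difference is thus -p, and [halfp] changes its sign. *)
Lemma halfp_revpB (r : nat) (p : {poly int}) :
  (2 * (size p).-1 < r)%N -> halfp r (revp r p - p) = p.
Proof.
move=> dp; apply/polyP=> i; rewrite /halfp coefN coef_poly coefB coef_revp.
have up j : (j < uphalf r)%N = (2 * j < r)%N.
  by rewrite uphalf_half; have := odd_double_half r; lia.
have z j : (r <= 2 * j)%N -> p`_j = 0.
  by move=> l; rewrite nth_default //; move: dp; move: (size p) => s; lia.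
rewrite up; case: ltnP => l; last by rewrite z ?oppr0.
by rewrite ifT ?(z (r - i)%N) ?sub0r ?opprK //; lia.
Qed.

Lemma degree_subp (r : nat) (p q : {poly int}) : (2 * (size p).-1 < r)%N ->
  (2 * (size q).-1 < r)%N -> (2 * (size (p - q)%R).-1 < r)%N.
Proof.
have := size_polyD p (- q); rewrite size_polyN.
move: (size _) (size _) (size _) => a b c; lia.
Qed.

End Polynomials.

(** * Rank one, Boolean and uniform matroids *)

Section SmallMatroids.
Context {T : finType}.
Implicit Types (M N : matroid T) (A B F G H S : {set T}).
Local Open Scope ring_scope.

Lemma KL_degreeP M : (0 < rank M)%N -> (2 * (size (KL M)).-1 < rank M)%N.
Proof. by move=> r; have /forallP/(_ M)/and3P[_ + _] := @KLP T; rewrite /KL_degree r. Qed.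

Lemma KL_eq M : revp (rank M) (KL M) =
  \sum_(F | flat M F) chi (localization M F) * KL (contraction M F).
Proof. by have /forallP/(_ M)/and3P[_ _ /eqP] := @KLP T. Qed.

Lemma inverse_KL_degreeP M : (0 < rank M)%N -> (2 * (size (inverse_KL M)).-1 < rank M)%N.
Proof. by move=> r; have /forallP/(_ M)/and3P[_ + _] := @inverse_KLP T; rewrite /KL_degree r. Qed.

Lemma inverse_KL_eq M : (-1) ^+ rank M * revp (rank M) (inverse_KL M) =
  \sum_(F | flat M F) (-1) ^+ rk M F * inverse_KL (localization M F)
    * revp (rank M - rk M F) (chi (contraction M F)).
Proof. by have /forallP/(_ M)/and3P[_ _ /eqP] := @inverse_KLP T. Qed.

Lemma inverse_KL_rank0E M : rank M = 0%N -> inverse_KL M = (ground M == set0)%:R.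
Proof.
move=> r; have /forallP/(_ M)/and3P[+ _ _] := @inverse_KLP T.
by rewrite /KL_rank0 r /= => /eqP ->; case: eqP.
Qed.

Lemma KL_rank0E M : rank M = 0%N -> KL M = (ground M == set0)%:R.
Proof.
move=> r; have /forallP/(_ M)/and3P[+ _ _] := @KLP T.
by rewrite /KL_rank0 r /= => /eqP ->; case: eqP.
Qed.

(** The defining recursion solved for the proper flats, in the form that [halfp_revpB] inverts. *)
Lemma inverse_KL_tail M : (-1) ^+ rank M * iKL_tail (@inverse_KL T) M =
  revp (rank M) (inverse_KL M) - inverse_KL M.
Proof.
have := inverse_KL_eq M; rewrite iKL_sumE => e.
have -> : iKL_tail (@inverse_KL T) M =
    (-1) ^+ rank M * (revp (rank M) (inverse_KL M) - inverse_KL M).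
  by rewrite mulrBr e addrAC subrr add0r.
by rewrite mulrA -expr2 sqrr_sign mul1r.
Qed.

Lemma flat_rank1 M F : rank M = 1%N -> flat M set0 ->
  flat M F = (F == set0) || (F == ground M).
Proof.
move=> r f0; apply/idP/orP=> [fF|[] /eqP -> //]; last exact: flat_ground.
have [|[x xF]] := set_0Vmem F; first by move/eqP; left.
right; apply/eqP/(flat_full_rank fF).
have /flatP[_ /(_ x)] := f0; rewrite (subsetP (flat_sub fF) _ xF) inE rk0 => /(_ isT isT).
have : (rk M [set x] <= rk M F)%N by rewrite rkS // sub1set.
by rewrite setU0; have := rk_le_rank M F; lia.
Qed.

(** Without loops, every nonempty set has rank 1, so its term is a bare sign. The alternating sum
    over all subsets vanishes, hence these signs add up to -1. *)
Lemma chi_rank1 M : rank M = 1%N -> flat M set0 -> chi M = 'X - 1.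
Proof.
move=> r f0; have ne : set0 != ground M.
  by apply/eqP=> e; move: r; rewrite /rank -e rk0.
have := sum_sign (sub0set (ground M)); rewrite (negPf ne).
rewrite (eq_bigl (fun A => A \subset ground M)); last by move=> A; rewrite sub0set.
rewrite /chi (bigD1 set0) ?sub0set //= cards0 => /eqP; rewrite addrC addr_eq0 => /eqP e.
rewrite (bigD1 set0) ?sub0set //= cards0 rk0 r mul1r; congr (_ + _); rewrite -[RHS]e.
apply: eq_bigr => A /andP[Ag /set0Pn[x xA]].
have /flatP[_ /(_ x)] := f0; rewrite (subsetP Ag _ xA) inE rk0 => /(_ isT isT).
have : (rk M [set x] <= rk M A)%N by rewrite rkS // sub1set.
rewrite setU0 => l1 l2; have -> : (1 - rk M A = 0)%N by lia.
by rewrite expr0 mulr1.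
Qed.

(** The only flats are the empty set and the ground set, so the recursion reads t P(1/t) = P + (t -
    1). The constant 1 solves it, and the degree bound makes the solution unique. *)
Lemma KL_rank1 M : rank M = 1%N -> flat M set0 -> KL M = 1.
Proof.
move=> r f0; have ne : ground M != set0.
  by apply/eqP=> e; move: r; rewrite /rank e rk0.
have dM := @KL_degreeP M; rewrite r in dM.
have := KL_eq M; rewrite (bigD1 set0) //= (bigD1 (ground M)) ?flat_ground //=.
rewrite big1; last first.
  by move=> F /andP[/andP[fF /negPf n0] /negPf n1]; move: fF; rewrite flat_rank1 // n0 n1.
rewrite contraction0 localizationT chi_empty // mul1r addr0 chi_rank1 //.
rewrite (@KL_rank0E (contraction _ _)) ?ground_contraction ?setDv ?eqxx ?mulr1; last first.
  by rewrite rank_contraction -/(rank M) subnn.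
rewrite r => e; apply/eqP; rewrite -subr_eq0; apply/eqP/(@revp_eq0 1) => //.
  by apply: degree_subp; [exact: dM|rewrite size_poly1].
have r1 : revp 1 1 = 'X by rewrite -(expr0 'X) revpXn // subn0 expr1.
by rewrite linearB /= e r1 addrA addrAC addrK.
Qed.

(** Serves the hyperplanes inside [H]: [H] itself in M, and the (k - 1)-subsets of [H] in the
    relaxation. Their contractions have known chi and P. *)
Lemma rank1_contraction M F : flat M F -> (rk M F).+1 = rank M ->
  rank (contraction M F) = 1%N /\ flat (contraction M F) set0.
Proof.
move=> fF r; rewrite rank_contraction flat_contraction ?sub0set ?flat_sub // set0U.
by split=> //; lia.
Qed.

Definition uniform M : Prop :=
  forall A, A \subset ground M -> rk M A = minn #|A| (rank M).

(** The characteristic polynomial of the uniform matroid of rank r on n elements; n = r is the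
    Boolean case. *)
Definition chi_uniform (r n : nat) : {poly int} :=
  \sum_(i < n.+1) (-1) ^+ i * 'X^(r - minn i r) *+ 'C(n, i).

Lemma chi_uniformE M : uniform M -> chi M = chi_uniform (rank M) #|ground M|.
Proof.
move=> u; rewrite /chi_uniform -[RHS](sum_by_card (ground M) predT
  (fun i => (-1) ^+ i * 'X^(rank M - minn i (rank M)))).
by apply: eq_big => [A|A sA]; rewrite ?andbT // u.
Qed.

Lemma uniform_localization M F : indep M F -> uniform (localization M F).
Proof.
move=> iF A AF; rewrite ground_localization in AF.
rewrite rank_localization rk_localization //.
have := indep_sub iF AF; move: iF; rewrite !indepE => /eqP <- /eqP <-.
by rewrite (minn_idPl _) // subset_leq_card.
Qed.

Lemma uniform_contraction M F : uniform M -> F \subset ground M ->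
  (#|F| <= rank M)%N -> uniform (contraction M F).
Proof.
move=> u Fg l A sA; have := sA; rewrite subsetD => /andP[Ag d].
rewrite rk_contraction // rank_contraction !u ?subUset ?Ag //.
have /eqP -> : (#|A :|: F| == #|A| + #|F|)%N by case: (leq_card_setU A F) => _ ->.
lia.
Qed.

Lemma flat_uniform M F : uniform M -> F \subset ground M ->
  flat M F = (F == ground M) || (#|F| < rank M)%N.
Proof.
move=> u Fg; apply/idP/orP=> [fF|[/eqP ->|lt]]; last 2 first.
- exact: flat_ground.
- by apply/flatP; split=> // x xg xF; rewrite !u ?subUset ?sub1set ?xg // cardsU1 xF; lia.
have [|ge] := ltnP #|F| (rank M); [by right|left].
by apply/eqP/flat_full_rank => //; rewrite u // (minn_idPr ge).
Qed.

Lemma iKL_tail_uniform Q M : uniform M -> iKL_tail Q M =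
  \sum_(F : {set T} | (F \subset ground M) && (#|F| < rank M)%N)
     (-1) ^+ #|F| * Q (localization M F) * revp (rank M - #|F|) (chi (contraction M F)).
Proof.
move=> u; apply: eq_big => [F|F /andP[fF ne]].
  have [Fg|nF] := boolP (F \subset ground M); last first.
    by apply/negP=> /andP[/flat_sub s _]; rewrite s in nF.
  rewrite flat_uniform //; case: eqP => //= [->|_]; last by rewrite andbT.
  by apply/esym/negbTE; rewrite -leqNgt rank_le_card.
have Fg := flat_sub fF; rewrite u // (minn_idPl _) //.
by move: fF; rewrite flat_uniform // (negPf ne) => /ltnW.
Qed.

(* Exchanging the two sums, the inner sum over the sets disjoint from B is alternating. *)
Lemma sum_boolean A :
  \sum_(F : {set T} | F \subset A) (-1) ^+ #|F| *
     (\sum_(B : {set T} | B \subset A :\: F) (-1) ^+ #|B| * 'X^(#|B|)) =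
  (-1) ^+ #|A| * 'X^(#|A|) :> {poly int}.
Proof.
under eq_bigr do rewrite mulr_sumr.
rewrite (exchange_big_dep (fun B => B \subset A)) /=; last first.
  by move=> F B _ s; apply: subset_trans s (subsetDl _ _).
transitivity (\sum_(B : {set T} | B \subset A) (-1) ^+ #|B| * 'X^#|B| * (A == B)%:R : {poly int}).
  apply: eq_bigr => B BA.
  have -> : (A == B) = (set0 == A :\: B).
    by rewrite [RHS]eq_sym setD_eq0 eqEsubset BA andbT.
  have := sum_sign (sub0set (A :\: B)); rewrite cards0.
  have -> : (if set0 == A :\: B then (-1) ^+ 0 else 0) = (set0 == A :\: B)%:R :> {poly int}.
    by case: eqP.
  move=> <-; rewrite mulr_sumr; apply: eq_big => [F|F _].
    by rewrite sub0set /= !subsetD BA disjoint_sym; case: (F \subset A).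
  by rewrite mulrC.
rewrite (bigD1 A) //= eqxx mulr1 big1 ?addr0 // => B /andP[_ ne].
by rewrite eq_sym (negPf ne) mulr0.
Qed.

(** By induction on the ground set every proper localization contributes Q = 1, and [sum_boolean]
    evaluates the resulting tail. The constant 1 then satisfies the same recursion as Q, within the
    degree bound. *)
Lemma inverse_KL_boolean M : indep M (ground M) -> inverse_KL M = 1.
Proof.
have [n] := ubnP #|ground M|; elim: n M => // n IH M ltn iM.
have rM : rank M = #|ground M| by move: iM; rewrite indepE => /eqP.
have [r0|rp] := posnP (rank M).
  by rewrite inverse_KL_rank0E //; move: r0; rewrite rM => /eqP; rewrite cards_eq0 => ->.
have u : uniform M by rewrite -(localizationT M); apply: uniform_localization.
have e := inverse_KL_tail M; rewrite iKL_tail_uniform // in e.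
(* After multiplication by (-1)^r the term of the full set is 1, so the signed sum over the proper
   subsets is X^r - 1. *)
have /(congr1 (fun p => (-1) ^+ rank M * p)) := sum_boolean (ground M).
rewrite mulrA -rM -expr2 sqrr_sign mul1r (bigD1 (ground M)) //= setDv.
rewrite -rM (eq_bigl (pred1 set0)) ?big_pred1_eq; last by move=> B; rewrite subset0.
rewrite cards0 mul1r mulrDr mulr1 -expr2 sqrr_sign => e'.
apply/eqP; rewrite -subr_eq0; apply/eqP/(revp_eq0 rp).
  by apply: degree_subp; rewrite ?inverse_KL_degreeP // size_poly1 muln0.
have -> : revp (rank M) (inverse_KL M - 1) = revp (rank M) (inverse_KL M) - 'X^(rank M).
  by rewrite linearB /= -(expr0 'X) revpXn // subn0.
suff -> : revp (rank M) (inverse_KL M) = inverse_KL M + ('X^(rank M) - 1).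
  by rewrite addrA addrAC addrK.
apply/eqP; rewrite addrC -subr_eq -e -e' addrC addKr.
rewrite eq_sym; apply/eqP; congr (_ * _); apply: eq_big => [F|F /andP[Fg ne]].
  apply: andb_id2l => Fg; rewrite rM.
  apply/idP/idP=> [ne|]; first by rewrite proper_card // properEneq ne.
  by apply: contraTneq => ->; rewrite ltnn.
have lt : (#|F| < #|ground M|)%N by rewrite proper_card // properEneq ne.
have iF := indep_sub iM Fg; have rF : rk M F = #|F| by move: iF; rewrite indepE => /eqP.
rewrite IH ?mulr1; first last.
- by rewrite ground_localization indepE rk_localization // rF.
- by rewrite ground_localization; lia.
congr (_ * _); rewrite -rF -rank_contraction revp_chi; apply: eq_bigr => B BF.
congr (_ * 'X^_); rewrite (uniform_contraction u Fg) ?rank_contraction ?rM ?rF //; last exact: ltnW.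
by have := subset_leq_card BF; rewrite cardsD (setIidPr Fg); lia.
Qed.

(** Q of the uniform matroid of rank r on n elements. Its proper flats are the sets of size i < r,
    whose localizations are Boolean with Q = 1, so no recursive call occurs. Rank 0 follows the
    convention for empty and nonempty ground sets. *)
Definition inverse_KL_uniform (r n : nat) : {poly int} :=
  if r == 0%N then (n == 0%N)%:R else
  halfp r ((-1) ^+ r * \sum_(i < n.+1 | (i < r)%N)
    ((-1) ^+ i * revp (r - i) (chi_uniform (r - i) (n - i))) *+ 'C(n, i)).

Lemma inverse_KL_uniformE M : uniform M ->
  inverse_KL M = inverse_KL_uniform (rank M) #|ground M|.
Proof.
move=> u; rewrite /inverse_KL_uniform; have [r0|rp] := posnP (rank M).
  by rewrite inverse_KL_rank0E // cards_eq0.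
rewrite -[LHS](halfp_revpB (inverse_KL_degreeP rp)) -inverse_KL_tail.
rewrite iKL_tail_uniform //; congr (halfp _ (_ * _)).
rewrite -(sum_by_card (ground M) (fun i => i < rank M)%N
  (fun i => (-1) ^+ i * revp (rank M - i) (chi_uniform (rank M - i) (#|ground M| - i)))).
apply: eq_bigr => F /andP[Fg lt].
have rF : rk M F = #|F| by rewrite u //; lia.
rewrite inverse_KL_boolean; last first.
  by rewrite ground_localization indepE rk_localization // rF.
rewrite mulr1 chi_uniformE; last by apply: uniform_contraction => //; apply: ltnW.
by rewrite rank_contraction rF ground_contraction cardsD (setIidPr Fg).
Qed.

End SmallMatroids.

(** * The difference polynomials and the comparison of sums over flats *)

Section Differences.
Local Open Scope ring_scope.

(** The change of the characteristic polynomial: a subset of [H] of size i passes from rank min(i, k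
    - 1) to min(i, k), and no other rank changes. *)
Definition dchi (k h : nat) : {poly int} :=
  \sum_(i < h.+1) (-1) ^+ i * ('X^(k - minn i k) - 'X^(k - minn i k.-1)) *+ 'C(h, i).

(* The first argument is fuel: any value at least [k] gives the same result. *)
Fixpoint dKL (n k h : nat) {struct n} : {poly int} :=
  if n is n'.+1 then
    if k == 1%N then 1 else
    halfp k (\sum_(i < h.+1 | (0 < i < k.-1)%N)
               chi_uniform i i * dKL n' (k - i) (h - i) *+ 'C(h, i)
             + (chi_uniform k.-1 k.-1 *+ 'C(h, k.-1) - chi_uniform k.-1 h)
             + dchi k h)
  else 0.

(** The sum comes from the flats of size below k - 1 in [H]. The bracket replaces the flat [H] by
    the (k - 1)-subsets of [H], all with P = 1 for the contraction. The fuel [k] suffices for each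
    rank k - i. *)
Definition dZ (k h : nat) : {poly int} :=
  \sum_(i < h.+1 | (i < k.-1)%N) 'X^i * dKL k (k - i) (h - i) *+ 'C(h, i)
  + ('X^(k.-1) *+ 'C(h, k.-1) - 'X^(k.-1)).

(** Not recursive, unlike [dKL]: Q is evaluated on localizations, which are Boolean at the small
    flats and uniform at [H], so there only chi of the contraction changes. *)
Definition dinverse_KL (k h : nat) : {poly int} :=
  halfp k ((-1) ^+ k *
    (\sum_(i < h.+1 | (i < k.-1)%N)
        (-1) ^+ i * revp (k - i) (dchi (k - i) (h - i)) *+ 'C(h, i)
     + (((-1) ^+ k.-1 * revp 1 ('X - 1)) *+ 'C(h, k.-1)
        - (-1) ^+ k.-1 * inverse_KL_uniform k.-1 h * revp 1 ('X - 1)))).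

Section Fixed.
Context {T : finType}.
Variables (M : matroid T) (H : {set T}) (sH : stressed_hyperplane M H).
Let N := relaxation sH.
Implicit Types (A B F G S : {set T}).

Lemma sum_draws (c : nat) (p : {poly int}) :
  \sum_(F : {set T} | (F \subset H) && (#|F| == c)) p = p *+ 'C(#|H|, c).
Proof.
by rewrite -cards_draws -sumr_const; apply: eq_bigl => F; rewrite inE.
Qed.

(** The common bookkeeping for P, Q and Z, with [f] the summand for the relaxation and [g] the one
    for M. Flats leaving [H] cancel except the ground set, and [H] is traded for its (k -
    1)-subsets. If |H| = k - 1, the set [H] is the only such subset. *)
Lemma sum_flat_relaxation (f g : {set T} -> {poly int}) :
  (forall F, flat M F -> ~~ (F \subset H) -> F != ground M -> f F = g F) ->
  \sum_(F | flat N F) f F - \sum_(F | flat M F) g F =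
    \sum_(F : {set T} | (F \subset H) && (#|F| < (rank M).-1)%N) (f F - g F)
    + (\sum_(F : {set T} | (F \subset H) && (#|F| == (rank M).-1)) f F - g H)
    + (f (ground M) - g (ground M)).
Proof.
move=> fg; have rH := stressed_rkH sH; have cH := stressed_card sH.
have nH := ground_nsub_stressed sH.
rewrite (bigID (fun F => F \subset H)) [X in _ - X](bigID (fun F => F \subset H)) /=.
have -> : \sum_(F | flat N F && (F \subset H)) f F =
    \sum_(F : {set T} | (F \subset H) && (#|F| < (rank M).-1)%N) f F +
    \sum_(F : {set T} | (F \subset H) && (#|F| == (rank M).-1)) f F.
  (* The flats of the relaxation inside [H] have size below k; size k - 1 is separated from the
     smaller ones. *)
  rewrite (bigID (fun F : {set T} => #|F| < (rank M).-1)%N) /=; congr (_ + _); apply: eq_bigl => F;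
  case: (boolP (F \subset H)) => [FH|]; rewrite ?andbF // flat_relaxation_sub //; lia.
have -> : \sum_(F | flat M F && (F \subset H)) g F =
    \sum_(F : {set T} | (F \subset H) && (#|F| < (rank M).-1)%N) g F + g H.
  rewrite (bigD1 H) /=; last by rewrite stressed_flat // subxx.
  rewrite addrC; congr (_ + _); apply: eq_bigl => F.
  case: (boolP (F \subset H)) => [FH|]; rewrite ?andbF // (flat_stressed sH) // andbT /=.
  by case: eqP => [->|]; rewrite ?andbT //=; lia.
have -> : \sum_(F | flat N F && ~~ (F \subset H)) f F =
    \sum_(F | flat M F && ~~ (F \subset H)) g F + (f (ground M) - g (ground M)).
  rewrite (bigD1 (ground M)) /=; last by rewrite nH -[X in flat _ X]/(ground N) flat_ground.
  rewrite [in RHS](bigD1 (ground M)) /=; last by rewrite nH flat_ground.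
  rewrite addrC [RHS]addrC addrA subrK [RHS]addrC; congr (_ + _).
  apply: eq_big => [F|F /andP[/andP[fF FH] ne]].
    by case: (boolP (F \subset H)) => FH; rewrite ?andbF // flat_relaxation_nsub.
  by rewrite fg // -(flat_relaxation_nsub sH).
rewrite sumrB.
set a := \sum_(F | _) f F; set b := \sum_(F | _) f F; set c := \sum_(F | _) g F.
by set d := \sum_(F | _) g F; ring.
Qed.

Lemma chi_relaxation : chi N = chi M + dchi (rank M) #|H|.
Proof.
apply/eqP; rewrite addrC -subr_eq; apply/eqP.
rewrite /chi rank_relaxation ground_relaxation -sumrB.
rewrite (bigID (fun A => A \subset H)) /= [X in _ + X]big1 ?addr0; last first.
  by move=> A /andP[Ag /negPf AH]; rewrite rk_relaxation // AH subrr.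
rewrite /dchi -[RHS](sum_by_card H predT (fun i => (-1) ^+ i *
  ('X^(rank M - minn i (rank M)) - 'X^(rank M - minn i (rank M).-1)))).
apply: eq_big => [A|A /andP[Ag AH]].
  by rewrite andbT; apply: andb_idl => AH; apply: subset_trans AH (stressed_sub sH).
by rewrite rk_relaxation // AH (stressed_rk sH) // mulrBr.
Qed.

Lemma rank1_contraction_stressed :
  rank (contraction M H) = 1%N /\ flat (contraction M H) set0.
Proof. by apply: rank1_contraction; rewrite ?stressed_flat ?stressed_rkH. Qed.

Lemma rank1_contraction_relaxation F : F \subset H -> #|F| = (rank M).-1 ->
  rank (contraction N F) = 1%N /\ flat (contraction N F) set0.
Proof.
move=> FH cF; have rH := stressed_rkH sH; apply: rank1_contraction.
  by rewrite flat_relaxation_sub //; lia.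
rewrite rk_relaxation ?FH ?rank_relaxation ?(subset_trans FH (stressed_sub sH)) //; lia.
Qed.

Lemma chi_localization_stressed F : F \subset H -> (#|F| < rank M)%N ->
  chi (localization M F) = chi_uniform #|F| #|F|.
Proof.
move=> FH lt; have iF := stressed_indep sH FH lt.
rewrite chi_uniformE; last exact: uniform_localization.
by rewrite rank_localization; move: iF; rewrite indepE => /eqP <-.
Qed.

Lemma uniform_localization_stressed : uniform (localization M H).
Proof.
move=> A AH; rewrite rank_localization rk_localization // (stressed_rk sH) //.
by rewrite -(stressed_rkH sH).
Qed.

Lemma rank_contraction_stressed F : F \subset H -> (#|F| < rank M)%N ->
  rank (contraction M F) = (rank M - #|F|)%N.
Proof.
move=> FH lt; rewrite rank_contraction; have := stressed_indep sH FH lt.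
by rewrite indepE => /eqP <-.
Qed.

Lemma card_stressedD F : F \subset H -> #|H :\: F| = (#|H| - #|F|)%N.
Proof. by move=> FH; rewrite cardsD (setIidPr FH). Qed.

End Fixed.

(** * The change of P, Z and Q under relaxation *)

Lemma KL_loop (T : finType) (M : matroid T) x :
  x \in ground M -> rk M [set x] = 0%N -> KL M = 0.
Proof.
move=> xg rx; have /forallP/(_ M)/and3P[a b /eqP c] := @KLP T.
(* A loop lies in every flat, so every summand of the recursion has a vanishing chi. *)
rewrite -(revpK (KL_size a b)) c big1 ?linear0 // => F fF.
by rewrite (chi_localization_loop rx xg fF) mul0r.
Qed.

(** Induction on the fuel [n], over all matroids at once, because the recursion passes to
    contractions. A flat F inside [H] with 0 < |F| < k - 1 contracts to a relaxation of smaller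
    rank, and H - F stays nonempty because k - 1 <= |H|. *)
Lemma KL_relaxation n (T : finType) (M : matroid T) (H : {set T})
    (sH : stressed_hyperplane M H) : (0 < #|H|)%N -> (rank M <= n)%N ->
  KL (relaxation sH) = KL M + dKL n (rank M) #|H|.
Proof.
elim: n T M H sH => [|n IH] T M H sH h0 rn; have rH := stressed_rkH sH; first lia.
(* In rank 1 the nonempty set [H] consists of loops, so P of M is 0. Relaxing makes the matroid
   loopless, with P = 1. *)
rewrite /=; have [r1|rn1] := eqVneq (rank M) 1%N.
  have /card_gt0P[x xH] := h0.
  rewrite (@KL_loop _ M x) ?add0r ?(subsetP (stressed_sub sH)) //; last first.
    by rewrite (stressed_rk sH) ?sub1set // r1 minn0.
  apply: KL_rank1; rewrite ?rank_relaxation //.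
  by rewrite flat_relaxation_sub ?sub0set // cards0 r1.
have rM : (1 < rank M)%N by lia.
set N := relaxation sH; have rN : rank N = rank M := rank_relaxation sH.
(* The degree bound holds for the difference, so [halfp_revpB] recovers it from this identity. *)
suff e : revp (rank M) (KL N - KL M) - (KL N - KL M) =
   \sum_(i < #|H|.+1 | (0 < i < (rank M).-1)%N)
      chi_uniform i i * dKL n (rank M - i) (#|H| - i) *+ 'C(#|H|, i)
    + (chi_uniform (rank M).-1 (rank M).-1 *+ 'C(#|H|, (rank M).-1)
       - chi_uniform (rank M).-1 #|H|)
    + dchi (rank M) #|H|.
  have d : (2 * (size (KL N - KL M)%R).-1 < rank M)%N.
    by apply: degree_subp; [rewrite -rN|]; apply: KL_degreeP; rewrite ?rN; lia.
  by have := halfp_revpB d; rewrite e => ->; rewrite addrC subrK.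
rewrite linearB /= -{1}rN !KL_eq (@sum_flat_relaxation _ _ _ sH); last first.
  move=> F fF FH ne; rewrite localization_relaxation_nsub //.
  by rewrite contraction_relaxation_nsub // flat_sub.
(* At the ground set the contraction is empty with P = 1, which leaves the difference of the
   characteristic polynomials. *)
have -> : chi (localization N (ground M)) * KL (contraction N (ground M))
   - chi (localization M (ground M)) * KL (contraction M (ground M)) = dchi (rank M) #|H|.
  rewrite contraction_relaxation_nsub ?ground_nsub_stressed // -{1}[ground M]/(ground N).
  rewrite !localizationT (@KL_rank0E _ (contraction _ _)).
    by rewrite ground_contraction setDv eqxx !mulr1 (chi_relaxation sH) addrAC subrr add0r.
  by rewrite rank_contraction -/(rank M) subnn.
have -> : chi (localization M H) * KL (contraction M H) = chi_uniform (rank M).-1 #|H|.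
  have [a b] := rank1_contraction_stressed sH.
  rewrite (KL_rank1 a b) mulr1 (chi_uniformE (uniform_localization_stressed sH)).
  by rewrite rank_localization -rH.
rewrite addrAC; congr (_ + _); rewrite addrAC; congr (_ + _); last first.
  congr (_ - _); rewrite -sum_draws; apply: eq_bigr => F /andP[FH /eqP cF].
  have [a b] := rank1_contraction_relaxation sH FH cF.
  rewrite (KL_rank1 a b) mulr1 localization_relaxation_sub //; last lia.
  by rewrite (chi_localization_stressed sH) // cF //; lia.
(* The empty flat contributes the unknown difference itself, which cancels the one subtracted on the
   left. Hence the condition 0 < i in [dKL]. *)
rewrite (bigD1 set0) /=; last by rewrite sub0set cards0; lia.
rewrite !contraction0 !chi_empty // !mul1r addrAC subrr add0r.
rewrite -(sum_by_card H (fun i => 0 < i < (rank M).-1)%N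
  (fun i => chi_uniform i i * dKL n (rank M - i) (#|H| - i))).
apply: eq_big => [F|F /andP[/andP[FH lt] ne]].
  by rewrite -card_gt0 andbAC -andbA.
have lt' : (#|F| < rank M)%N by lia.
rewrite localization_relaxation_sub // -mulrBr (contraction_relaxation_sub sH FH lt).
have F0 : (0 < #|F|)%N by rewrite card_gt0.
have cH := stressed_card sH.
rewrite IH ?card_stressedD ?(rank_contraction_stressed sH) //; [|lia..].
by rewrite addrAC subrr add0r (chi_localization_stressed sH).
Qed.

(** Z is an explicit sum of P over contractions, so the change of P determines its change without a
    degree argument. *)
Lemma Zpoly_relaxation (T : finType) (M : matroid T) (H : {set T})
    (sH : stressed_hyperplane M H) : (0 < #|H|)%N ->
  Zpoly (relaxation sH) = Zpoly M + dZ (rank M) #|H|.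
Proof.
move=> h0; have rH := stressed_rkH sH; set N := relaxation sH.
have Hg := stressed_sub sH; have cH := stressed_card sH.
apply/eqP; rewrite addrC -subr_eq; apply/eqP.
rewrite /Zpoly (@sum_flat_relaxation _ _ _ sH); last first.
  move=> F fF FH ne; rewrite contraction_relaxation_nsub ?flat_sub //.
  by rewrite rk_relaxation ?flat_sub // (negPf FH).
rewrite contraction_relaxation_nsub ?ground_nsub_stressed //.
have -> : rk N (ground M) = rk M (ground M) by exact: (rank_relaxation sH).
rewrite subrr addr0 /dZ; congr (_ + (_ - _)).
- rewrite -(sum_by_card H (fun i => i < (rank M).-1)%N
    (fun i => 'X^i * dKL (rank M) (rank M - i) (#|H| - i))).
  apply: eq_bigr => F /andP[FH lt].
  have rF : rk M F = #|F| by rewrite (stressed_rk sH) //; lia.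
  have -> : rk N F = #|F|.
    by rewrite rk_relaxation ?FH ?(subset_trans FH Hg) //; lia.
  rewrite rF -mulrBr (contraction_relaxation_sub sH FH lt) (@KL_relaxation (rank M)).
  - rewrite card_stressedD // (rank_contraction_stressed sH) //; last lia.
    by rewrite addrAC subrr add0r.
  - by rewrite card_stressedD //; lia.
  by rewrite rank_contraction leq_subr.
- rewrite -sum_draws; apply: eq_bigr => F /andP[FH /eqP cF].
  have [a b] := rank1_contraction_relaxation sH FH cF.
  rewrite (KL_rank1 a b) mulr1 rk_relaxation ?FH ?(subset_trans FH Hg) // cF.
  by congr 'X^_; lia.
have [a b] := rank1_contraction_stressed sH.
by rewrite (KL_rank1 a b) mulr1 -rH.
Qed.

Lemma inverse_KL_relaxation (T : finType) (M : matroid T) (H : {set T})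
    (sH : stressed_hyperplane M H) :
  inverse_KL (relaxation sH) = inverse_KL M + dinverse_KL (rank M) #|H|.
Proof.
have rH := stressed_rkH sH; set N := relaxation sH.
have Hg := stressed_sub sH; have rN : rank N = rank M := rank_relaxation sH.
have r0 : (0 < rank M)%N by rewrite -rH.
suff e : revp (rank M) (inverse_KL N - inverse_KL M) - (inverse_KL N - inverse_KL M) =
  (-1) ^+ rank M *
    (\sum_(i < #|H|.+1 | (i < (rank M).-1)%N)
        (-1) ^+ i * revp (rank M - i) (dchi (rank M - i) (#|H| - i)) *+ 'C(#|H|, i)
     + (((-1) ^+ (rank M).-1 * revp 1 ('X - 1)) *+ 'C(#|H|, (rank M).-1)
        - (-1) ^+ (rank M).-1 * inverse_KL_uniform (rank M).-1 #|H| * revp 1 ('X - 1))).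
  have d : (2 * (size (inverse_KL N - inverse_KL M)%R).-1 < rank M)%N.
    by apply: degree_subp; [rewrite -rN|]; apply: inverse_KL_degreeP; rewrite ?rN; lia.
  by have := halfp_revpB d; rewrite e /dinverse_KL => ->; rewrite addrC subrK.
set R := (X in _ = _ * X); set s := (-1) ^+ rank M.
(* The recursion for Q carries the sign s = (-1)^k; since s * s = 1 it can be moved across. *)
suff e : s * revp (rank M) (inverse_KL N) - s * revp (rank M) (inverse_KL M)
    = R + (s * inverse_KL N - s * inverse_KL M).
  have ss : s * s = 1 by rewrite -expr2 sqrr_sign.
  rewrite linearB /= -[LHS]mul1r -ss -mulrA; congr (_ * _).
  by rewrite -[RHS](addrK (s * inverse_KL N - s * inverse_KL M)) -e; ring.
rewrite /s-{1 2}rN !inverse_KL_eq (@sum_flat_relaxation _ _ _ sH); last first.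
  move=> F fF FH ne; rewrite contraction_relaxation_nsub ?flat_sub //.
  by rewrite localization_relaxation_nsub // rk_relaxation ?flat_sub // (negPf FH) rN.
rewrite rN; congr (_ + (_ - _) + _).
- rewrite -(sum_by_card H (fun i => i < (rank M).-1)%N
    (fun i => (-1) ^+ i * revp (rank M - i) (dchi (rank M - i) (#|H| - i)))).
  apply: eq_bigr => F /andP[FH lt].
  have iF : indep M F by apply: (stressed_indep sH) => //; lia.
  have rF : rk M F = #|F| by move: iF; rewrite indepE => /eqP.
  have -> : rk N F = #|F|.
    by rewrite rk_relaxation ?FH ?(subset_trans FH Hg) //; lia.
  rewrite localization_relaxation_sub //; last lia.
  rewrite rF -mulrBr (contraction_relaxation_sub sH FH lt) chi_relaxation.
  rewrite card_stressedD // (rank_contraction_stressed sH) //; last lia.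
  rewrite linearD /= addrAC subrr add0r inverse_KL_boolean ?mulr1 //.
  by rewrite ground_localization indepE rk_localization // rF.
- rewrite -sum_draws; apply: eq_bigr => F /andP[FH /eqP cF].
  have iF : indep M F by apply: (stressed_indep sH) => //; lia.
  have [a b] := rank1_contraction_relaxation sH FH cF.
  rewrite (chi_rank1 a b) rk_relaxation ?FH ?(subset_trans FH Hg) // cF.
  rewrite localization_relaxation_sub //; last lia.
  rewrite inverse_KL_boolean ?mulr1; last first.
    by move: iF; rewrite ground_localization !indepE rk_localization.
  by congr ((-1) ^+ _ * revp _ _); lia.
- have [a b] := rank1_contraction_stressed sH.
  rewrite (chi_rank1 a b) (inverse_KL_uniformE (uniform_localization_stressed sH)).
  by rewrite rank_localization -rH subSnn.
(* The ground set contributes s times the unknown difference, the last summand on the right. *)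
rewrite contraction_relaxation_nsub ?ground_nsub_stressed //.
rewrite -{1 2 3 4}[ground M]/(ground N) !localizationT -/(rank M) -/(rank N) rN subnn.
rewrite chi_empty ?revp01 ?mulr1 //.
by rewrite ground_contraction setDv.
Qed.

End Differences.

Theorem theorem4p1 (k h : nat) (k_ge1 : 1 <= k) (h_ge1 : 1 <= h) :
  exists p q z : {poly int},
  forall (T : finType) (M : matroid T) (H : {set T})
         (sH : stressed_hyperplane M H),
  rank M = k -> #|H| = h ->
  [/\ KL (relaxation sH) = (KL M + p)%R,
      inverse_KL (relaxation sH) = (inverse_KL M + q)%R
    & Zpoly (relaxation sH) = (Zpoly M + z)%R].
Proof.
(* The witnesses involve only k and h, so they are fixed before the matroid; the rank k serves as
   fuel. *)
exists (dKL k k h), (dinverse_KL k h), (dZ k h) => T M H sH rM cH.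
rewrite -rM -cH in h_ge1 *; split.
- exact: KL_relaxation.
- exact: inverse_KL_relaxation.
exact: Zpoly_relaxation.
Qed.
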